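(* Let $\mathcal V$ be an $N=2$ superconformal raviolo vertex algebra and let $(\mathcal V_B,D_B)$ be its $B$-twist. The bracket $$\{\!\{O_1,O_2\}\!\}:=\tfrac12\Big(O^{[1]}_{1,(0)}O_2-(-1)^{|O_1||O_2|}O^{[1]}_{2,(0)}O_1\Big),\qquad O^{[1]}:=Q^-_{(0)}O,$$ equips the $D_B$-cohomology $H^\bullet(\mathcal V_B,D_B)$ (a graded-commutative associative algebra under the normally-ordered product) with the structure of a $2$-shifted Poisson algebra.
   Context: **Raviolo vertex algebras.** $\mathcal K=\mathbb C\langle\!\langle z\rangle\!\rangle$ is the graded-commutative algebra with degree $0$ part $\mathbb C[[z]]$ and degree $1$ part with basis $\Omega^m_z$ ($m\ge0$), where $z^n\Omega^m_z=\Omega^{m-n}_z$ if $n\le m$ and $0$ otherwise, and products of two degree $1$ elements vanish; $\partial_zz^n=nz^{n-1}$, $\partial_z\Omega^m_z=-(m+1)\Omega^{m+1}_z$. $R\langle\!\langle z\rangle\!\rangle$ is the analogue with coefficients in $R$; $\mathcal K_{dist}$ allows infinite sums in both degrees. $\mathcal K_{z,w,z-w}$ is the graded-commutative $\mathbb C[[z,w]]$-algebra generated by degree $1$ elements $\Omega^m_x$ ($x\in\{z,w,z-w\}$, $m\ge0$) with $x^n\Omega^m_x=\Omega^{m-n}_x$ ($n\le m$), $=0$ ($n>m$), $\Omega^m_x\Omega^n_x=0$, and $\Omega^0_{z-w}\Omega^0_z+\Omega^0_w\Omega^0_{z-w}+\Omega^0_z\Omega^0_w=0$ together with all relations obtained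 from the latter by acting with $z,w,\partial_z,\partial_w$. It maps to $\mathbb C\langle\!\langle z\rangle\!\rangle\langle\!\langle w\rangle\!\rangle$ by $\Omega^m_{z-w}\mapsto\sum_{n\ge0}\binom{m+n}{n}w^n\Omega^{m+n}_z$ and to $\mathbb C\langle\!\langle w\rangle\!\rangle\langle\!\langle z\rangle\!\rangle$ by $\Omega^m_{z-w}\mapsto(-1)^m\sum_{n\ge0}\binom{m+n}{n}z^n\Omega^{m+n}_w$. A raviolo vertex algebra with spin grading is a vector space $\mathcal V=\bigoplus\mathcal V^{r,(j)}$ graded by $R$-charge $r$ and spin $j$, with a $\mathbb Z/2$ parity $|\cdot|$ governing all Koszul signs (even = bosonic, odd = fermionic; the total cohomological plus super parity), a vacuum $|0\rangle$ of bidegree $(0,0)$, an even translation operator $\partial$ of bidegree $(0,1)$ with $\partial|0\rangle=0$, and a linear bidegree-$(0,0)$, parity-preserving map $O\mapsto O(z)=Y(O,z)=\sum_{m<0}z^{-m-1}O_{(m)}+\sum_{m\ge0}\Omega^m_zO_{(m)}$, $O_{(m)}\in\mathrm{End}(\mathcal V)$, where $z$ has spin $-1$, $\Omega^m_z$ has spin $m+1$, $\Omega^m_z$ is odd of $R$-charge $1$ (so for $O$ of $R$-charge $r$, $O_{(m)}$ has $R$-charge $r$ and parity $|O|$ if $m<0$, and $R$-charge $r-1$ and parity $|O|+1$ if $m\ge0$; $O_{(m)}$ raises spin by $j-m-1$), such that: for all $O,v$, $O_{(m)}v=0$ for $m\gg0$; $Y(|0\rangle,z)=\mathrm{id}$,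 $O(z)|0\rangle\in\mathcal V[[z]]$ with value $O$ at $z=0$; $[\partial,O(z)]=\partial_zO(z)$; and locality: for all $O_1,O_2,v\in\mathcal V$, $\varphi\in\mathcal V^\vee$, the matrix elements $\langle\varphi,O_1(z)O_2(w)v\rangle$ and $(-1)^{|O_1||O_2|}\langle\varphi,O_2(w)O_1(z)v\rangle$ are the expansions of one element of $\mathcal K_{z,w,z-w}$, in which the coefficient of $\Omega^l_{z-w}$ vanishes for $l\gg0$. One may also work linearly over a graded-commutative $\mathbb C$-algebra $\mathsf S$ (of spin $0$). ''Operator'' means element of $\mathcal V$. The OPE notation $O_1(z)O_2(w)\sim\sum_{m\ge0}\Omega^m_{z-w}A_m(w)$ means $O_{1,(m)}O_2=A_m$ for all $m\ge0$; the OPE is regular ($\sim0$) if all vanish. The normally-ordered product is $:\!O_1O_2\!:\;=O_{1,(-1)}O_2$. **$N=2$ superconformal structure** (central charge $\xi$, an odd degree $1$ element of $\mathsf S$, possibly $0$): fermionic operators $\Gamma$ ($R$-charge 1, spin 2), $\sigma$ ($R$-charge 1, spin 1) and bosonic $Q^\pm$ ($R$-charge 1, spin $\frac32$) with $\Gamma_{(0)}=\partial$, $\Gamma_{(1)}$ = spin, and $\Gamma\Gamma\sim\Omega^3_{z-w}\xi/2+2\Omega^1_{z-w}\Gamma+\Omega^0_{z-w}\partial\Gamma$, $\sigma\sigma\sim\Omega^1_{z-w}\xi/3$, $\Gamma\sigma\sim\Omega^1_{z-w}\sigma+\Omega^0_{z-w}\partial\sigma$, $\Gamma Q^\pm\sim\frac32\Omega^1_{z-w}Q^\pm+\Omega^0_{z-w}\partial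 Q^\pm$, $\sigma Q^\pm\sim\pm\Omega^0_{z-w}Q^\pm$, $Q^\pm Q^\pm\sim0$, $Q^\pm Q^\mp\sim\Omega^2_{z-w}(-\xi/3)\mp\Omega^1_{z-w}\sigma+\Omega^0_{z-w}(-\Gamma\mp\frac12\partial\sigma)$ (first factor at $z$, second and right side at $w$). $\mathcal V$ is also graded by $S$-charge, the eigenvalue of $\sigma_{(0)}$. **$B$-twist.** $\mathcal V_B$ is the raviolo vertex algebra $\mathcal V$ with its $R$-charge and spin gradings replaced by the Higgs branch $R$-charge $R_B=R+\sigma_{(0)}$ and Higgs branch spin $J_B=J-\frac12\sigma_{(0)}$ ($J$ = spin), and stress tensor $\Gamma_B=\Gamma+\frac12\partial\sigma$. One sets $Q_B=Q^+$, $\widetilde Q_B=Q^-$, and $D_B=Q^+_{(0)}$, an odd square-zero derivation of $R_B$-degree 1. The pair $(\mathcal V_B,D_B)$ is the $B$-twist of $\mathcal V$. The operator $O^{[1]}=\widetilde Q_{B,(0)}O$ is the holomorphic descendant of $O$. **2-shifted Poisson algebra**: a graded-commutative associative algebra with a graded skew-symmetric bracket of degree $-2$ (here with respect to $R_B$) satisfying the graded Jacobi identity and acting by graded derivations of the product.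
   Formalization: Locality is taken to include operator product associativity (the same element of K_{z,w,z-w} also expands to the matrix elements of Y(Y(O_1,z-w)O_2,w)v, with a pole bound uniform in v and φ); with only the two stated expansions the Jacobi identity can fail. *)

(* Defs.v *)
From HB Require Import structures.
From mathcomp Require Import all_boot all_order all_algebra.
From mathcomp Require Import generic_quotient ring_quotient.
From mathcomp Require Import boolp classical_sets fsbigop reals.
From mathcomp Require Export complex.

Set Implicit Arguments.
Unset Strict Implicit.
Unset Printing Implicit Defensive.

Import GRing.Theory.
Local Open Scope ring_scope.
Local Open Scope quotient_scope.

Definition span_of (V : nmodType) (P : V -> Prop) (v : V) : Prop :=
  exists s : seq V, (forall u, u \in s -> P u) /\ v = \sum_(u <- s) u.

Definition direct_sum (V : zmodType) (I : choiceType) (W : I -> V -> Prop) :=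
  [/\ (forall i, W i 0),
      (forall i u v, W i u -> W i v -> W i (u - v)),
      (forall v, exists (s : seq I) (f : I -> V),
         (forall i, W i (f i)) /\ v = \sum_(i <- s) f i)
    & (forall (s : seq I) (f : I -> V), uniq s -> (forall i, W i (f i)) ->
         \sum_(i <- s) f i = 0 -> forall i, i \in s -> f i = 0)].

(* Gradings are indexed by the ground field K, so that integral, fractional  *)
(* and arbitrary numerical charges are all covered.  Parities are booleans   *)
(* (true = odd), independent of the charges, and alone govern the signs.     *)
Record gcalg (K : fieldType) := GCAlg {
  gc_sort :> algType K;
  gc_gr : bool -> K -> gc_sort -> Prop;
  gc_dir : direct_sum (fun i : bool * K => gc_gr i.1 i.2);
  gc_scale : forall p r k s, gc_gr p r s -> gc_gr p r (k *: s);
  gc_one : gc_gr false 0 1;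
  gc_mul : forall p r s q t u, gc_gr p r s -> gc_gr q t u ->
    gc_gr (p (+) q) (r + t) (s * u);
  gc_comm : forall p r s q t u, gc_gr p r s -> gc_gr q t u ->
    s * u = (-1) ^+ (p && q) * (u * s)
}.

Arguments gc_gr {K} g _ _ _.

Section TwoPointFunctions.
Variable K : fieldType.

(* For m : int let e_m(z) = z^(-m-1) if m < 0 and e_m(z) = Omega^m_z if      *)
(* 0 <= m.  A two-variable expression is given by its coefficients F m n on  *)
(* e_m(z) e_n(w), in this order.                                             *)
Definition dist2 := int -> int -> K.

(* e_a(x) e_b(x) is e_(a+b+1)(x) if [ebasis_nz a b], and 0 otherwise.        *)
Definition ebasis_nz (a b : int) : bool :=
  ~~ ((0 <= a) && (0 <= b)) && (((0 <= a) || (0 <= b)) ==> (0 <= a + b + 1)).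

(* The sign comes from moving e_c(z) to the left of e_b(w), where c = m-1-a. *)
(* The sum is finite whenever F and G are both in C<<z>><<w>>, or both in    *)
(* C<<w>><<z>>; these are the only cases used.                               *)
Definition mul2 (F G : dist2) : dist2 := fun m n =>
  \sum_(x \in [set: int * int])
    (if ebasis_nz x.1 (m - 1 - x.1) && ebasis_nz x.2 (n - 1 - x.2)
     then (-1) ^+ ((0 <= x.2) && (0 <= m - 1 - x.1))
            * F x.1 x.2 * G (m - 1 - x.1) (n - 1 - x.2)
     else 0).

Definition one2 : dist2 := fun a b => ((a == -1) && (b == -1))%:R.

(* f i j is the coefficient of z^i w^j. *)
Definition series2 (f : nat -> nat -> K) : dist2 := fun a b =>
  if (a < 0) && (b < 0) then f (absz (a + 1)) (absz (b + 1)) else 0.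

Inductive point := Pz | Pw | Pzw.

(* (x, m) stands for Omega^m_x. *)
Definition gen : Type := point * nat.

(* The image of Omega^m_x in C<<z>><<w>>. *)
Definition gen_zw (g : gen) : dist2 := fun a b =>
  match g with
  | (Pz, m) => ((a == m%:Z) && (b == -1))%:R
  | (Pw, m) => ((a == -1) && (b == m%:Z))%:R
  | (Pzw, m) => if (b < 0) && (a == m%:Z - b - 1) then 'C(absz a, m)%:R else 0
  end.

(* The image of Omega^m_x in C<<w>><<z>>. *)
Definition gen_wz (g : gen) : dist2 := fun a b =>
  match g with
  | (Pz, m) => ((a == m%:Z) && (b == -1))%:R
  | (Pw, m) => ((a == -1) && (b == m%:Z))%:R
  | (Pzw, m) => if (a < 0) && (b == m%:Z - a - 1)
                then (-1) ^+ m * 'C(absz b, m)%:R else 0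
  end.

(* The image of Omega^m_x in C<<w>><<u>>, where u = z - w takes the place of *)
(* z as first variable:                                                      *)
(*   Omega^m_z = \sum_n (-1)^n 'C(m+n, n) u^n Omega^(m+n)_w.                 *)
Definition gen_uw (g : gen) : dist2 := fun a b =>
  match g with
  | (Pz, m) => if (a < 0) && (b == m%:Z - a - 1)
               then (-1) ^+ absz (a + 1) * 'C(absz b, m)%:R else 0
  | (Pw, m) => ((a == -1) && (b == m%:Z))%:R
  | (Pzw, m) => ((a == m%:Z) && (b == -1))%:R
  end.

(* f(z, w) = f(u + w, w) as a series in u and w. *)
Definition series_uw (f : nat -> nat -> K) : nat -> nat -> K := fun i j =>
  \sum_(k < j.+1) 'C(i + k, i)%:R * f (i + k)%N (j - k)%N.

(* K_{z,w,z-w} is spanned over C[[z,w]] by the products of its generators.   *)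
(* An element is given by a representative, a finite sum of terms            *)
(*   f(z,w) Omega^{m_1}_{x_1} ... Omega^{m_k}_{x_k}.                         *)
(* The defining relations hold in all three images, so the expansions of an  *)
(* element can be computed on any representative.                            *)
Definition Kzw : Type := seq ((nat -> nat -> K) * seq gen).

Definition expand (ser : (nat -> nat -> K) -> nat -> nat -> K)
    (iota : gen -> dist2) (e : Kzw) : dist2 := fun m n =>
  \sum_(t <- e)
    mul2 (series2 (ser t.1)) (foldr (fun g F => mul2 (iota g) F) one2 t.2) m n.

Definition expand_zw : Kzw -> dist2 := expand id gen_zw.
Definition expand_wz : Kzw -> dist2 := expand id gen_wz.
Definition expand_uw : Kzw -> dist2 := expand series_uw gen_uw.

(* Only Omega^l_{z-w} with l < L occur. *)
Definition polar_below (L : nat) (e : Kzw) : bool :=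
  all (fun t : (nat -> nat -> K) * seq gen =>
    all (fun g : gen => if g is (Pzw, l) then (l < L)%N else true) t.2) e.

End TwoPointFunctions.

Section Locality.
Variables (K : fieldType) (S : gcalg K) (V : lmodType S).

(* Linear over the ground field, whose scalars k act on V as k%:A.           *)
Definition is_functional (phi : V -> K) : Prop :=
  (forall u v, phi (u + v) = phi u + phi v) /\
  (forall k v, phi (k%:A *: v) = k * phi v).

(* Matrix elements for a and b of parities p and q.  The signs bring         *)
(* e_m(z) e_n(w) to the left of the modes, a_(m) being of parity             *)
(* p + [0 <= m]; in the second condition they also put e_m(z) before e_n(w). *)
(* The third condition, for Y(Y(a,z-w)b,w)v, is the associativity of the     *)
(* operator product: it identifies the coefficient of Omega^l_{z-w} in e     *)
(* with that of (a_(l) b)(w)v.  It does not follow from the first two        *)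
(* conditions, because the first two expansions are independent of each      *)
(* other in degree 2: they do not relate [a_(m), b_(n)], m, n >= 0, to the   *)
(* products a_(l) b.                                                         *)
Definition mutually_local (mode : V -> int -> V -> V) (p q : bool) (a b : V) :=
  exists L : nat, forall (v : V) (phi : V -> K), is_functional phi ->
  exists e : Kzw K,
    [/\ polar_below L e,
        (forall m n, expand_zw e m n =
           (-1) ^+ ((0 <= n) && (p (+) (0 <= m)))
             * phi (mode a m (mode b n v))),
        (forall m n, expand_wz e m n =
           (-1) ^+ (p && q) * ((-1) ^+ ((0 <= m) && q)
             * phi (mode b n (mode a m v))))
      & (forall m n, expand_uw e m n = phi (mode (mode a m b) n v))].

End Locality.

Definition parity_part (K : fieldType) (V : nmodType)
    (gr : bool -> K -> K -> V -> Prop) (p : bool) : V -> Prop :=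
  span_of (fun u => exists r j, gr p r j u).

(* rv_mode O m v is O_(m) v.  The sign in rv_modeZl comes from               *)
(* s Omega^m = (-1)^|s| Omega^m s.                                           *)
Record raviolo (K : fieldType) (S : gcalg K) := Raviolo {
  rv_sort :> lmodType S;
  rv_gr : bool -> K -> K -> rv_sort -> Prop;
  rv_vac : rv_sort;
  rv_der : {linear rv_sort -> rv_sort};
  rv_mode : rv_sort -> int -> rv_sort -> rv_sort;
  rv_dir : direct_sum (fun i : bool * K * K => rv_gr i.1.1 i.1.2 i.2);
  rv_grZ : forall p r s q t j v, gc_gr S p r s -> rv_gr q t j v ->
    rv_gr (p (+) q) (r + t) j (s *: v);
  rv_vac_gr : rv_gr false 0 0 rv_vac;
  rv_der_gr : forall p r j v, rv_gr p r j v -> rv_gr p r (j + 1) (rv_der v);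
  rv_der_vac : rv_der rv_vac = 0;
  rv_modeDl : forall a b m v,
    rv_mode (a + b) m v = rv_mode a m v + rv_mode b m v;
  rv_modeDr : forall a m u v,
    rv_mode a m (u + v) = rv_mode a m u + rv_mode a m v;
  rv_modeZl : forall p r s a m v, gc_gr S p r s ->
    rv_mode (s *: a) m v = (-1) ^+ (p && (0 <= m)) *: (s *: rv_mode a m v);
  rv_modeZr : forall p r s q a m v, gc_gr S p r s -> parity_part rv_gr q a ->
    rv_mode a m (s *: v) =
      (-1) ^+ (p && (q (+) (0 <= m))) *: (s *: rv_mode a m v);
  rv_mode_gr : forall p r j a q t i v (m : int),
    rv_gr p r j a -> rv_gr q t i v ->
    rv_gr (p (+) q (+) (0 <= m)) (r + t - (if 0 <= m then 1 else 0))
      (j + i - m%:~R - 1) (rv_mode a m v);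
  rv_field : forall a v, exists N : nat, forall m : nat, (N <= m)%N ->
    rv_mode a m%:Z v = 0;
  rv_mode_vac : forall m v, rv_mode rv_vac m v = if m == -1 then v else 0;
  rv_creation_reg : forall a (m : nat), rv_mode a m%:Z rv_vac = 0;
  rv_creation : forall a, rv_mode a (-1) rv_vac = a;
  rv_translation : forall a m v,
    rv_der (rv_mode a m v) - rv_mode a m (rv_der v)
      = - (rv_mode a (m - 1) v *~ m);
  rv_local : forall p q a b, parity_part rv_gr p a -> parity_part rv_gr q b ->
    mutually_local rv_mode p q a b
}.

Arguments rv_gr {K S} _ _ _ _ _.
Arguments rv_vac {K S} _.
Arguments rv_der {K S} _.
Arguments rv_mode {K S} _ _ _ _.

Definition rv_par (K : fieldType) (S : gcalg K) (V : raviolo S) (p : bool) :=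
  parity_part (rv_gr V) p.

Arguments rv_par {K S} V p _.

Section Superconformal.
Variables (K : fieldType) (S : gcalg K) (V : raviolo S).

(* A(z) B(w) ~ \sum_m Omega^m_{z-w} s_m(w) *)
Definition ope (a b : V) (s : seq V) : Prop :=
  forall m : nat, rv_mode V a m%:Z b = s`_m.

(* The numerical factors c of the OPEs act as c%:A. *)
Record superconformal := Superconformal {
  sc_xi : S;
  sc_Gamma : V;
  sc_sigma : V;
  sc_Qp : V;
  sc_Qm : V;
  sc_xi_gr : gc_gr S true 1 sc_xi;
  sc_Gamma_gr : rv_gr V true 1 2 sc_Gamma;
  sc_sigma_gr : rv_gr V true 1 1 sc_sigma;
  sc_Qp_gr : rv_gr V false 1 (3 / 2) sc_Qp;
  sc_Qm_gr : rv_gr V false 1 (3 / 2) sc_Qm;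
  sc_Gamma0 : forall v, rv_mode V sc_Gamma 0 v = rv_der V v;
  sc_Gamma1 : forall p r j v, rv_gr V p r j v ->
    rv_mode V sc_Gamma 1 v = j%:A *: v;
  sc_GammaGamma : ope sc_Gamma sc_Gamma
    [:: rv_der V sc_Gamma; 2 *: sc_Gamma; 0; (2^-1 *: sc_xi) *: rv_vac V];
  sc_sigmasigma : ope sc_sigma sc_sigma
    [:: 0; (3^-1 *: sc_xi) *: rv_vac V];
  sc_Gammasigma : ope sc_Gamma sc_sigma [:: rv_der V sc_sigma; sc_sigma];
  sc_GammaQp : ope sc_Gamma sc_Qp [:: rv_der V sc_Qp; (3 / 2)%:A *: sc_Qp];
  sc_GammaQm : ope sc_Gamma sc_Qm [:: rv_der V sc_Qm; (3 / 2)%:A *: sc_Qm];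
  sc_sigmaQp : ope sc_sigma sc_Qp [:: sc_Qp];
  sc_sigmaQm : ope sc_sigma sc_Qm [:: - sc_Qm];
  sc_QpQp : ope sc_Qp sc_Qp [::];
  sc_QmQm : ope sc_Qm sc_Qm [::];
  sc_QpQm : ope sc_Qp sc_Qm
    [:: - sc_Gamma - 2^-1%:A *: rv_der V sc_sigma;
        - sc_sigma;
        - ((3^-1 *: sc_xi) *: rv_vac V)];
  sc_QmQp : ope sc_Qm sc_Qp
    [:: - sc_Gamma + 2^-1%:A *: rv_der V sc_sigma;
        sc_sigma;
        - ((3^-1 *: sc_xi) *: rv_vac V)];
  sc_Scharge : direct_sum (fun (s : K) (v : V) =>
    rv_mode V sc_sigma 0 v = s%:A *: v)
}.

End Superconformal.

(* The last two fields hold when d is S-linear up to Koszul signs; they make *)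
(* its kernel and its image S-submodules.                                    *)
Record differential (S : pzRingType) (V : lmodType S) := Differential {
  dif :> V -> V;
  difB : {morph dif : u v / u - v};
  difZ : forall s, exists s', forall v, dif (s *: v) = s' *: dif v;
  difZV : forall s, exists s', forall v, s *: dif v = dif (s' *: v)
}.

Section Cohomology.
Variables (S : pzRingType) (V : lmodType S) (d : differential V).

Definition closed_pred : {pred V} := fun v => d v == 0.

Fact closed_zmod : zmod_closed closed_pred.
Proof.
split=> [|u v]; rewrite !unfold_in.
  by rewrite -[X in d X](subrr 0) difB subrr.
by move=> /eqP du /eqP dv; rewrite difB du dv subrr.
Qed.
HB.instance Definition _ := GRing.isZmodClosed.Build V closed_pred closed_zmod.

Record cocycle := Cocycle { cocycle_val : V; _ : cocycle_val \in closed_pred }.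

HB.instance Definition _ := [isSub for cocycle_val].
HB.instance Definition _ := [Choice of cocycle by <:].
HB.instance Definition _ := [SubChoice_isSubZmodule of cocycle by <:].

Definition exact_pred : {pred cocycle} :=
  fun z => `[< exists u, val z = d u >].

Fact exact_zmod : zmod_closed exact_pred.
Proof.
split=> [|y z]; rewrite !unfold_in.
  by apply/asboolP; exists 0; rewrite -[X in d X](subrr 0) difB subrr.
move=> /asboolP[u yu] /asboolP[v zv]; apply/asboolP; exists (u - v).
by rewrite raddfB /= yu zv difB.
Qed.
HB.instance Definition _ := GRing.isZmodClosed.Build cocycle exact_pred exact_zmod.

Local Notation B := (Quotient.quot exact_pred).

Fact cocycle_scale_subproof s (z : cocycle) : s *: val z \in closed_pred.
Proof.
case: z => v /= dv; have [s' e] := difZ d s.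
by move: dv; rewrite !unfold_in e => /eqP ->; rewrite scaler0.
Qed.

Definition cocycle_scale s (z : cocycle) : cocycle :=
  Cocycle (cocycle_scale_subproof s z).

(* ker d / (ker d :&: im d), so that d \o d = 0 is not needed. *)
Definition cohomology : Type := B.
HB.instance Definition _ := GRing.Zmodule.on cohomology.

Definition coh_class (z : cocycle) : cohomology := \pi_B z.

Definition coh_scale s (x : cohomology) : cohomology :=
  coh_class (cocycle_scale s (repr (x : B))).

Lemma coh_classP (y z : cocycle) :
  coh_class y = coh_class z <-> exists u, val y - val z = d u.
Proof.
rewrite /coh_class; split.
  move/eqP; rewrite -Quotient.idealrBE unfold_in => /asboolP[u e].
  by exists u; rewrite -e raddfB.
move=> [u e]; apply/eqP; rewrite -Quotient.idealrBE unfold_in.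
by apply/asboolP; exists u; rewrite raddfB.
Qed.

Lemma coh_classB y z : coh_class (y - z) = coh_class y - coh_class z.
Proof. exact: (raddfB \pi_B). Qed.

Lemma coh_classD y z : coh_class (y + z) = coh_class y + coh_class z.
Proof. exact: (raddfD \pi_B). Qed.

Lemma coh_class_repr (x : cohomology) : coh_class (repr (x : B)) = x.
Proof. exact: reprK. Qed.

Lemma coh_scale_class s z :
  coh_scale s (coh_class z) = coh_class (cocycle_scale s z).
Proof.
apply/coh_classP; rewrite /= -scalerBr.
have /coh_classP[u ->] := coh_class_repr (coh_class z).
by have [s' e] := difZV d s; exists (s' *: u); rewrite -e.
Qed.

Lemma coh_classE (x : cohomology) : exists z, x = coh_class z.
Proof. by exists (repr (x : B)); rewrite coh_class_repr. Qed.

Fact coh_scaleA s t x : coh_scale s (coh_scale t x) = coh_scale (s * t) x.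
Proof.
have [z ->] := coh_classE x; rewrite !coh_scale_class; congr coh_class.
by apply: val_inj; rewrite /= scalerA.
Qed.

Fact coh_scale1 : left_id 1 coh_scale.
Proof.
move=> x; have [z ->] := coh_classE x; rewrite coh_scale_class.
by congr coh_class; apply: val_inj; rewrite /= scale1r.
Qed.

Fact coh_scaleDr : right_distributive coh_scale +%R.
Proof.
move=> s x y; have [z ->] := coh_classE x; have [t ->] := coh_classE y.
rewrite -coh_classD !coh_scale_class -coh_classD; congr coh_class.
by apply: val_inj; rewrite /= scalerDr.
Qed.

Fact coh_scaleDl x : {morph coh_scale^~ x : s t / s + t}.
Proof.
move=> s t; have [z ->] := coh_classE x.
rewrite !coh_scale_class -coh_classD; congr coh_class.
by apply: val_inj; rewrite /= scalerDl.
Qed.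

HB.instance Definition _ := GRing.Zmodule_isLmodule.Build S cohomology
  coh_scaleA coh_scale1 coh_scaleDr coh_scaleDl.

Definition represents (x : cohomology) (v : V) : Prop :=
  exists z : cocycle, val z = v /\ x = coh_class z.

End Cohomology.

(* The signs involve parities only; the charge is shifted by -2. *)
Record is_2shifted_poisson (K : fieldType) (S : gcalg K) (H : lmodType S)
    (gr : bool -> K -> H -> Prop) (one : H) (mul br : H -> H -> H) : Prop := {
  sp_dir : direct_sum (fun i : bool * K => gr i.1 i.2);
  sp_grZ : forall p r s q t x, gc_gr S p r s -> gr q t x ->
    gr (p (+) q) (r + t) (s *: x);

  sp_mulDl : forall x y z, mul (x + y) z = mul x z + mul y z;
  sp_mulDr : forall x y z, mul x (y + z) = mul x y + mul x z;
  sp_mulZl : forall s x y, mul (s *: x) y = s *: mul x y;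
  sp_mulZr : forall p r s q t x y, gc_gr S p r s -> gr q t x ->
    mul x (s *: y) = (-1) ^+ (p && q) *: (s *: mul x y);
  sp_mul_gr : forall p r x q t y, gr p r x -> gr q t y ->
    gr (p (+) q) (r + t) (mul x y);
  sp_one_gr : gr false 0 one;
  sp_mul1 : left_id one mul;
  sp_mulA : associative mul;
  sp_mulC : forall p r x q t y, gr p r x -> gr q t y ->
    mul x y = (-1) ^+ (p && q) *: mul y x;

  sp_brDl : forall x y z, br (x + y) z = br x z + br y z;
  sp_brDr : forall x y z, br x (y + z) = br x y + br x z;
  sp_brZl : forall s x y, br (s *: x) y = s *: br x y;
  sp_brZr : forall p r s q t x y, gc_gr S p r s -> gr q t x ->
    br x (s *: y) = (-1) ^+ (p && q) *: (s *: br x y);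
  sp_br_gr : forall p r x q t y, gr p r x -> gr q t y ->
    gr (p (+) q) (r + t - 2) (br x y);
  sp_brC : forall p r x q t y, gr p r x -> gr q t y ->
    br x y = - ((-1) ^+ (p && q) *: br y x);
  sp_jacobi : forall p r x q t y z, gr p r x -> gr q t y ->
    br x (br y z) = br (br x y) z + (-1) ^+ (p && q) *: br y (br x z);
  sp_leibniz : forall p r x q t y z, gr p r x -> gr q t y ->
    br x (mul y z) = mul (br x y) z + (-1) ^+ (p && q) *: mul y (br x z)
}.

Section BTwist.
Variables (K : fieldType) (S : gcalg K) (V : raviolo S).
Variable N : superconformal V.

(* Parity p, R_B-charge a and spin J_B = b. *)
Definition B_gr (p : bool) (a b : K) : V -> Prop :=
  span_of (fun u => exists r j s,
    [/\ rv_gr V p r j u, rv_mode V (sc_sigma N) 0 u = s%:A *: u,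
        a = r + s & b = j - s / 2]).

Definition DB_fun : V -> V := rv_mode V (sc_Qp N) 0.

Fact DB_funB : {morph DB_fun : u v / u - v}.
Proof.
move=> u v; rewrite /DB_fun; apply: (addIr (rv_mode V (sc_Qp N) 0 v)).
by rewrite -rv_modeDr !subrK.
Qed.

Fact DB_fun_gcalg p r s v : gc_gr S p r s ->
  DB_fun (s *: v) = (-1) ^+ p *: (s *: DB_fun v).
Proof.
move=> sS; rewrite /DB_fun (rv_modeZr (q := false) _ _ sS) ?andbT //.
exists [:: sc_Qp N]; split; last by rewrite big_seq1.
by move=> u; rewrite inE => /eqP ->; exists 1, (3 / 2); exact: sc_Qp_gr.
Qed.

Fact DB_fun0 : DB_fun 0 = 0.
Proof. by rewrite -[X in DB_fun X](subrr 0) DB_funB subrr. Qed.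

Fact DB_funD : {morph DB_fun : u v / u + v}.
Proof. by move=> u v; rewrite /DB_fun rv_modeDr. Qed.

Fact DB_fun_sum (I : Type) (r : seq I) (F : I -> V) :
  DB_fun (\sum_(i <- r) F i) = \sum_(i <- r) DB_fun (F i).
Proof. exact: (big_morph _ DB_funD DB_fun0). Qed.

Fact DB_funZ s : exists s', forall v, DB_fun (s *: v) = s' *: DB_fun v.
Proof.
have [_ _ dec _] := gc_dir S; have [t [f [fS ->]]] := dec s.
exists (\sum_(i <- t) (-1) ^+ i.1 * f i) => v.
rewrite !scaler_suml DB_fun_sum; apply: eq_bigr => i _.
by rewrite (DB_fun_gcalg _ (fS i)) scalerA.
Qed.

Fact DB_funZV s : exists s', forall v, s *: DB_fun v = DB_fun (s' *: v).
Proof.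
have [_ _ dec _] := gc_dir S; have [t [f [fS ->]]] := dec s.
exists (\sum_(i <- t) (-1) ^+ i.1 * f i) => v.
rewrite !scaler_suml DB_fun_sum; apply: eq_bigr => i _.
have -> : (-1) ^+ i.1 * f i = if i.1 then - f i else f i.
  by case: (i.1); rewrite ?mul1r // expr1 mulN1r.
case: (i.1) (DB_fun_gcalg v (fS i)) => e.
  by rewrite scaleNr -sub0r DB_funB DB_fun0 sub0r e expr1 scaleN1r opprK.
by rewrite e scale1r.
Qed.

Definition D_B : differential V := Differential DB_funB DB_funZ DB_funZV.

Definition descendant (v : V) : V := rv_mode V (sc_Qm N) 0 v.

Definition H_B : lmodType S := cohomology D_B.

(* Parity p and R_B-charge a. *)
Definition H_B_gr (p : bool) (a : K) (x : H_B) : Prop :=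
  exists v, represents x v /\ span_of (fun u => exists b, B_gr p a b u) v.

Definition normal_product (u v : V) : V := rv_mode V u (-1) v.

(* Meant for u and v of parities p and q. *)
Definition descent_bracket (p q : bool) (u v : V) : V :=
  2^-1%:A *: (rv_mode V (descendant u) 0 v
              - (-1) ^+ (p && q) *: rv_mode V (descendant v) 0 u).

End BTwist.

(* Main.v *)
Require Import Defs.
From mathcomp Require Import all_boot all_order all_algebra.
From mathcomp Require Import boolp classical_sets fsbigop.
From mathcomp Require Import reals complex.
From mathcomp Require Import zify ring.

Set Implicit Arguments.
Unset Strict Implicit.
Unset Printing Implicit Defensive.

(** Write D for Q^+_(0) and Q for Q^-_(0).  The theorem rests on three facts
    on modes, each of which compares the three expansions of one two-point
    function:
    - the (-1)-product is commutative and associative on the nose, since in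
      degree 0 a two-point function is just a power series in z and w
      ([regular_comm], [regular_assoc]);
    - a_(0) is a derivation of the (-1)-product and of all the n-th products
      with n >= 0, which is the residue theorem in z for the expansions around
      z = infinity, z = 0 and z = w ([residue_regular], [residue_polar]);
    - b_(0) a is, up to sign, the alternating sum of the divided derivatives of
      the a_(k) b ([skew_symmetry]).

    The last two concern degrees 1 and 2, where a two-point function is a sum of
    series times one or two generators, and they are checked on such terms.
    Locality is stated through matrix elements, and linear functionals separate
    points by Zorn's lemma ([functional_ext]).

    The superconformal relations then give D Q + Q D = der ([homotopy]) and
    Q Q = 0, so that translations act trivially on D-cohomology.  The cochain
    operation {a, b} = (Q a)_(0) b is biadditive, preserves cocycles, and sends
    a coboundary and a cocycle to a coboundary.  It satisfies the Jacobi and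
    Leibniz identities already on cochains, because (Q a)_(0) is a derivation
    and Q Q = 0 ([descent_jacobi], [descent_leibniz]).  Its antisymmetry only
    holds on cohomology ([descent_antisymmetric]); granted that, the
    antisymmetrised bracket of the theorem and the operation {a, b} have the
    same class.

    Finally V is the direct sum of its components of given parity, R-charge,
    spin and S-charge, and D shifts the twisted charge by 1, so that cocycles
    and coboundaries split into components and the cohomology is graded
    ([cohomology_direct]). *)

Import Order.TTheory GRing.Theory Num.Theory.
Local Open Scope ring_scope.

(** * Products of two-variable expressions *)

Section FormalDistributions.
Variable K : fieldType.
Implicit Types (F G : dist2 K) (f : nat -> nat -> K).

Lemma fsum_seq (I : choiceType) (s : seq I) (F : I -> K) :
  uniq s -> (forall i, i \notin s -> F i = 0) ->
  \sum_(i \in [set: I]) F i = \sum_(i <- s) F i.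
Proof.
move=> us F0; rewrite (fsbigE s) // => [|i _]; last exact: F0.
by under eq_bigl do rewrite in_setT.
Qed.

(** The summand of [mul2] has a name so that the sum over all pairs of integers
    can be cut down to a finite list outside which it vanishes. *)
Definition mul2_term F G (m n : int) (x : int * int) : K :=
  if ebasis_nz x.1 (m - 1 - x.1) && ebasis_nz x.2 (n - 1 - x.2)
  then (-1) ^+ ((0 <= x.2) && (0 <= m - 1 - x.1))
         * F x.1 x.2 * G (m - 1 - x.1) (n - 1 - x.2)
  else 0.

Lemma mul2_eq F G m n s : uniq s ->
  (forall x, x \notin s -> mul2_term F G m n x = 0) ->
  mul2 F G m n = \sum_(x <- s) mul2_term F G m n x.
Proof. exact: fsum_seq. Qed.

Lemma mul2_eq0 F G m n : (forall x, mul2_term F G m n x = 0) ->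
  mul2 F G m n = 0.
Proof. by move=> F0; rewrite (@mul2_eq _ _ _ _ [::]) ?big_nil. Qed.

Lemma mul2_neq0 F G m n : mul2 F G m n != 0 ->
  exists x1 x2, [/\ ebasis_nz x1 (m - 1 - x1), ebasis_nz x2 (n - 1 - x2),
    F x1 x2 != 0 & G (m - 1 - x1) (n - 1 - x2) != 0].
Proof.
move=> FG; apply: contrapT => nx; case/eqP: FG; apply: mul2_eq0 => -[x1 x2].
rewrite /mul2_term /=; case: ifP => // /andP[e1 e2].
have [->|F0] := eqVneq (F x1 x2) 0; first by rewrite mulr0 mul0r.
have [->|G0] := eqVneq (G (m - 1 - x1) (n - 1 - x2)) 0; first by rewrite mulr0.
by case: nx; exists x1, x2.
Qed.

(** The cohomological degree, in which each Omega counts for 1. *)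
Definition has_degree (d : nat) F := forall a b : int, F a b != 0 ->
  ((0 <= a)%R + (0 <= b)%R)%N = d.

(** The spin, shifted by 2: e_a(x) e_b(y) has spin a + b + 2.  The images of a
    generator are infinite sums, but homogeneous ones, and this is what makes
    the products below finite sums. *)
Definition has_weight (M : int) F := forall a b, F a b != 0 -> a + b = M.

Lemma mul2_degree d e F G : has_degree d F -> has_degree e G ->
  has_degree (d + e) (mul2 F G).
Proof.
move=> dF eG m n /mul2_neq0[x1 [x2 [e1 e2 /dF <- /eG <-]]].
by move: e1 e2; rewrite /ebasis_nz; lia.
Qed.

Lemma mul2_weight M N F G : has_weight M F -> has_weight N G ->
  has_weight (M + N + 2) (mul2 F G).
Proof.
by move=> MF NG m n /mul2_neq0[x1 [x2 [_ _ /MF <- /NG <-]]]; lia.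
Qed.

(** In a nonvanishing summand exactly one of the two variables is polar in F and
    the other one in G, so that exchanging F and G flips the Koszul sign. *)
Lemma mul2_anticomm F G m n : has_degree 1 F -> has_degree 1 G ->
  mul2 F G m n = - mul2 G F m n.
Proof.
move=> dF dG; rewrite /mul2.
pose h (x : int * int) := (m - 1 - x.1, n - 1 - x.2).
have hK : involutive h by case=> a b; rewrite /h /=; congr pair; lia.
(* h exchanges the indices of the two factors. *)
rewrite [in RHS](@reindex_fsbigT _ _ _ _ _ h); last exact: inv_bij.
rewrite -[RHS]mulN1r mulr_fsumr; apply: eq_fsbigr => -[a b] _ /=.
have -> : m - 1 - (m - 1 - a) = a by lia.
have -> : n - 1 - (n - 1 - b) = b by lia.
rewrite /ebasis_nz (addrC (m - 1 - a)) (addrC (n - 1 - b)).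
rewrite [(0 <= m - 1 - a) && _]andbC [(0 <= n - 1 - b) && _]andbC.
rewrite [(0 <= m - 1 - a) || _]orbC [(0 <= n - 1 - b) || _]orbC.
case: ifP => [/andP[e1 e2]|]; last by rewrite mulr0.
have [->|/dF F0] := eqVneq (F a b) 0; first by rewrite !(mulr0,mul0r).
have [->|/dG G0] := eqVneq (G (m - 1 - a) (n - 1 - b)) 0.
  by rewrite !(mulr0,mul0r).
rewrite -!mulrA [_ a b * _]mulrC !mulrA -exprS; congr (_ * _ * _).
move: e1 e2 F0 G0; case: (0 <= a); case: (0 <= b);
 case: (0 <= m - 1 - a); case: (0 <= n - 1 - b) => //= *;
 by rewrite expr0 sqrrN expr1n.
Qed.

Lemma mul2_pointr F G c d m n : (forall a b, (a, b) != (c, d) -> G a b = 0) ->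
  mul2 F G m n = mul2_term F G m n (m - 1 - c, n - 1 - d).
Proof.
move=> G0; rewrite (@mul2_eq _ _ _ _ [:: (m - 1 - c, n - 1 - d)]) ?big_seq1 //.
move=> [a b]; rewrite inE /mul2_term /= => ne; case: ifP => // _.
rewrite G0 ?mulr0 //; apply: contra ne => /eqP[<- <-].
by apply/eqP; congr pair; lia.
Qed.

Lemma mul2_one2 F m n : mul2 F (@one2 K) m n = F m n.
Proof.
rewrite (@mul2_pointr _ _ (-1) (-1)); last first.
  by move=> a b; rewrite /one2 xpair_eqE => /negbTE ->.
rewrite /mul2_term /= /one2.
have e (k : int) : k - 1 - (k - 1 - -1) = -1 by lia.
have -> : m - 1 - -1 = m by lia.
have -> : n - 1 - -1 = n by lia.
have -> : m - 1 - m = -1 by lia.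
have -> : n - 1 - n = -1 by lia.
rewrite !eqxx mulr1 andbF mul1r /ebasis_nz ifT //; lia.
Qed.

Lemma series2_degree f : has_degree 0 (series2 f).
Proof. by move=> a b; rewrite /series2; case: ifP => //; rewrite ?eqxx //; lia. Qed.

Lemma one2_degree : has_degree 0 (@one2 K).
Proof.
by move=> a b; rewrite /one2; case: andP => [[/eqP -> /eqP ->]|]; rewrite ?eqxx.
Qed.

(** Multiplication by z^i takes e_(m+i)(z) to e_m(z), except that it kills
    e_(m+i)(z) when m < 0 <= m + i. *)
Definition truncated (m : int) (i : nat) : bool := (0 <= m + i%:Z) ==> (0 <= m).

(** By homogeneity only the monomials z^i w^(N-i) reach the given coefficient. *)
Lemma mul2_series f G M m n (N : nat) : has_weight M G -> M = m + n + N%:Z ->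
  mul2 (series2 f) G m n =
  \sum_(i < N.+1) (if truncated m i && truncated n (N - i)
    then f i (N - i)%N * G (m + i%:Z) (n + (N - i)%:Z) else 0).
Proof.
move=> wG eM.
rewrite (@mul2_eq _ _ _ _ [seq (Negz i, Negz (N - i)) | i <- iota 0 N.+1]).
- rewrite big_map -[iota 0 N.+1]/(index_iota 0 N.+1) big_mkord.
  apply: eq_bigr => i _; rewrite /mul2_term /=.
  have -> : m - 1 - Negz i = m + i%:Z by lia.
  have -> : n - 1 - Negz (N - i) = n + (N - i)%:Z by lia.
  rewrite /series2 /=.
  have -> : absz (Negz i + 1) = i by lia.
  have -> : absz (Negz (N - i) + 1) = (N - i)%N by lia.
  rewrite mul1r; congr (if _ && _ then _ else _); rewrite /ebasis_nz /truncated;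
  lia.
- by rewrite map_inj_uniq ?iota_uniq // => i j [].
move=> [a b] /mapP ne; rewrite /mul2_term /=; case: ifP => // _.
rewrite /series2; case: ifP => [ab0|_]; last by rewrite mulr0 mul0r.
have [->|/wG G0] := eqVneq (G (m - 1 - a) (n - 1 - b)) 0; first by rewrite mulr0.
case: ne; exists (absz (a + 1)); first by rewrite mem_iota; lia.
by congr pair; lia.
Qed.

Lemma mul2_series_lt f G M m n : has_weight M G -> M < m + n ->
  mul2 (series2 f) G m n = 0.
Proof.
move=> wG eM; apply: mul2_eq0 => -[a b]; rewrite /mul2_term /=; case: ifP => // _.
rewrite /series2; case: ifP => [ab0|_]; last by rewrite mulr0 mul0r.
have [->|/wG G0] := eqVneq (G (m - 1 - a) (n - 1 - b)) 0; first by rewrite mulr0.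
lia.
Qed.

End FormalDistributions.

(** * The three expansions of a two-point function *)

Section Expansions.
Variable K : fieldType.
Implicit Types (F G : dist2 K) (f : nat -> nat -> K) (g : gen) (e : Kzw K).

Local Ltac by_support :=
  by move=> a b /=; case: (boolP (_ && _)) => //=; rewrite ?eqxx //; lia.

Lemma gen_zw_degree g : has_degree 1 (@gen_zw K g).
Proof. by case: g => -[] m; by_support. Qed.

Lemma gen_zw_weight g : has_weight (g.2%:Z - 1) (@gen_zw K g).
Proof. by case: g => -[] m; by_support. Qed.

Lemma gen_wz_degree g : has_degree 1 (@gen_wz K g).
Proof. by case: g => -[] m; by_support. Qed.

Lemma gen_wz_weight g : has_weight (g.2%:Z - 1) (@gen_wz K g).
Proof. by case: g => -[] m; by_support. Qed.

Lemma gen_uw_degree g : has_degree 1 (@gen_uw K g).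
Proof. by case: g => -[] m; by_support. Qed.

Lemma gen_uw_weight g : has_weight (g.2%:Z - 1) (@gen_uw K g).
Proof. by case: g => -[] m; by_support. Qed.

(** Compare the coefficients of x^l in (1 - x)^i (1 - x)^(-k-1) and
    (1 - x)^(i-k-1).  For i > k the last power is a polynomial of degree
    i - k - 1, which is less than l by hypothesis. *)
Lemma sum_bin_alternating (i l k : nat) : (i <= l + k)%N ->
  \sum_(t < l.+1) (-1) ^+ t * ('C(i, t) * 'C(l - t + k, k))%:R
    = 'C(l + k - i, l)%:R :> K.
Proof.
elim: i l => [|i IHi] l lei.
  rewrite big_ord_recl big1 ?addr0 => [|j _]; last by rewrite bin0n mul0n mulr0.
  by rewrite mul1r bin0 mul1n !subn0 -[in RHS]bin_sub ?leq_addr // addKn.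
case: l lei => [|l] lei.
  by rewrite big_ord1 !bin0 add0n binn mul1r.
rewrite big_ord_recl /=.
transitivity (\sum_(t < l.+2)
      (-1) ^+ t * ('C(i, t) * 'C(l.+1 - t + k, k))%:R
    - \sum_(t < l.+1) (-1) ^+ t * ('C(i, t) * 'C(l - t + k, k))%:R : K).
  rewrite [in RHS]big_ord_recl /= -addrA; congr (_ + _); first by rewrite !bin0.
  rewrite -sumrB; apply: eq_bigr => t _.
  rewrite /bump /= add1n binS mulnDl natrD subSS exprS; ring.
rewrite !IHi; [|lia..].
have -> : (l.+1 + k - i = (l + k - i).+1)%N by lia.
have -> : (l.+1 + k - i.+1 = l + k - i)%N by lia.
by rewrite binS natrD addrK.
Qed.

(** A product of two series in the Omega^m_z with coefficients in w vanishes. *)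
Lemma mul2_same_side F G m n :
  (forall a b, F a b != 0 -> 0 <= a) -> (forall a b, G a b != 0 -> 0 <= a) ->
  mul2 F G m n = 0.
Proof.
move=> F0 G0; apply: contrapT => /eqP/mul2_neq0[a [b [e _ /F0 a0 /G0 ma]]].
by move: e; rewrite /ebasis_nz a0 ma.
Qed.

Lemma mul2_same_side_r F G m n :
  (forall a b, F a b != 0 -> 0 <= b) -> (forall a b, G a b != 0 -> 0 <= b) ->
  mul2 F G m n = 0.
Proof.
move=> F0 G0; apply: contrapT => /eqP/mul2_neq0[a [b [_ e /F0 a0 /G0 ma]]].
by move: e; rewrite /ebasis_nz a0 ma.
Qed.

Lemma mul2_Omega_w F k (a b : nat) :
  mul2 F (gen_zw K (Pw, k)) a b =
    if (b <= k)%N then F a (b%:Z - 1 - k%:Z) else 0.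
Proof.
rewrite (@mul2_pointr _ _ _ (-1) k); last first.
  by move=> x y; rewrite /= xpair_eqE => /negbTE ->.
rewrite /mul2_term /=.
have -> : a%:Z - 1 - -1 = a%:Z by lia.
have -> : a%:Z - 1 - a%:Z = -1 by lia.
have -> : b%:Z - 1 - (b%:Z - 1 - k%:Z) = k%:Z by lia.
rewrite andbF !eqxx mulr1 mul1r; congr (if _ then _ else _).
by rewrite /ebasis_nz; lia.
Qed.

Lemma mul2_Omega_z F k (a b : nat) :
  mul2 F (gen_zw K (Pz, k)) a b =
    if (a <= k)%N then - F (a%:Z - 1 - k%:Z) b else 0.
Proof.
rewrite (@mul2_pointr _ _ _ k (-1)); last first.
  by move=> x y; rewrite /= xpair_eqE => /negbTE ->.
rewrite /mul2_term /=.
have -> : a%:Z - 1 - (a%:Z - 1 - k%:Z) = k%:Z by lia.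
have -> : b%:Z - 1 - -1 = b%:Z by lia.
have -> : b%:Z - 1 - b%:Z = -1 by lia.
rewrite !eqxx mulr1 mulN1r; congr (if _ then _ else _).
by rewrite /ebasis_nz; lia.
Qed.

(** The residue theorem in the first variable after multiplication by z^i, for
    P, Q and T the images of one element of degree 2; the right-hand side
    expands z^i as (u + w)^i.  The index c is that of w. *)
Definition residue_identity (P Q T : dist2 K) : Prop := forall i c : nat,
  P i c - Q i c = \sum_(t < i.+1) 'C(i, t)%:R * T t (c + i - t)%N.

(** Up to order there are six pairs of types of generators.  Both sides are 0
    for equal types, and for Omega_z Omega_w since it has no pole at z = w.  For
    Omega_{z-w} Omega_w only the expansions in z, w and in u, w survive.  The
    remaining case Omega_{z-w} Omega_z needs [sum_bin_alternating]. *)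
Lemma residue_identity_gens g g' : residue_identity
  (mul2 (gen_zw K g) (gen_zw K g')) (mul2 (gen_wz K g) (gen_wz K g'))
  (mul2 (gen_uw K g) (gen_uw K g')).
Proof.
have sym h h' : residue_identity
    (mul2 (gen_zw K h) (gen_zw K h')) (mul2 (gen_wz K h) (gen_wz K h'))
    (mul2 (gen_uw K h) (gen_uw K h')) -> residue_identity
    (mul2 (gen_zw K h') (gen_zw K h)) (mul2 (gen_wz K h') (gen_wz K h))
    (mul2 (gen_uw K h') (gen_uw K h)).
  move=> id i c; rewrite mul2_anticomm; try exact: gen_zw_degree.
  rewrite [in X in _ - X]mul2_anticomm; try exact: gen_wz_degree.
  rewrite -opprD id -sumrN; apply: eq_bigr => t _.
  by rewrite [in RHS]mul2_anticomm ?mulrN //; exact: gen_uw_degree.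
wlog: g g' / match g.1, g'.1 with
  | Pzw, Pz | Pzw, Pw | Pz, Pw | Pz, Pz | Pw, Pw | Pzw, Pzw => true
  | _, _ => false end.
  by move=> id; case: g g' => [[] l] [[] k]; do [exact: id | exact/sym/id].
case: g g' => [[] l] [[] k] // _ i c.
- rewrite (mul2_same_side i c) ?[X in 0 - X](mul2_same_side i c); try by_support.
  by rewrite subrr big1 // => t _; rewrite mul2_same_side_r ?mulr0 //; by_support.
- rewrite subrr big1 // => t _; rewrite mul2_same_side_r ?mulr0 //; by_support.
- rewrite (mul2_same_side_r i c) ?[X in 0 - X](mul2_same_side_r i c); try by_support.
  by rewrite subrr big1 // => t _; rewrite mul2_same_side_r ?mulr0 //; by_support.
- rewrite (mul2_same_side i c) ?sub0r; try by_support.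
  rewrite (mul2_Omega_z (gen_wz K (Pzw, l)) k i c).
  under eq_bigr => t _.
    rewrite mul2_anticomm; try exact: gen_uw_degree.
    rewrite (mul2_Omega_z (gen_uw K (Pz, k)) l).
    over.
  (* Both sides are supported on i + c = l + k by homogeneity. *)
  have [eM|neM] := eqVneq (i + c)%N (l + k)%N; last first.
    rewrite big1 => [|t _].
      by case: ifP => ?; rewrite ?oppr0 //= ifF ?oppr0 //; lia.
    case: ifP => ?; rewrite ?oppr0 ?mulr0 //= ifF ?oppr0 ?mulr0 //.
    by have := ltn_ord t; lia.
  have ec : c = (l + k - i)%N by lia.
  transitivity ((-1) ^+ l * 'C(c, l)%:R : K).
    case: ifP => ik; first by rewrite opprK /= ifT //; lia.
    by rewrite oppr0 bin_small ?mulr0 //; lia.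
  rewrite ec -sum_bin_alternating; last by lia.
  (* The two sums have different ranges, but the same nonzero terms. *)
  pose F t : K := if (t <= l)%N && (t <= i)%N
                  then (-1) ^+ (l - t) * ('C(i, t) * 'C(l - t + k, k))%:R else 0.
  transitivity (\sum_(t < l.+1) F t).
    rewrite mulr_sumr; apply: eq_bigr => t _; rewrite /F -ltnS ltn_ord /=.
    case: leqP => it; last by rewrite (bin_small it) mul0n !mulr0.
    rewrite mulrA -exprD; congr (_ * _).
    have -> : (l + t = l - t + t.*2)%N by have := ltn_ord t; lia.
    by rewrite exprD -[in X in _ * X]mul2n exprM sqrrN !expr1n mulr1.
  transitivity (\sum_(t < i.+1) F t).
    rewrite (big_ord_widen (l + i).+1 F) ?ltnS ?leq_addr //.
    rewrite [RHS](big_ord_widen (l + i).+1 F) ?ltnS ?leq_addl //.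
    rewrite [LHS]big_mkcond [RHS]big_mkcond; apply: eq_bigr => t _.
    by rewrite /F !ltnS; case: (t <= l)%N; case: (t <= i)%N.
  apply: eq_bigr => t _; have lti := ltn_ord t; rewrite /F.
  have -> : (t <= i)%N by rewrite -ltnS.
  rewrite andbT; case: leqP => tl; last by rewrite oppr0 mulr0.
  rewrite /= opprK ifT; last by lia.
  rewrite natrM mulrCA; congr (_ * ((-1) ^+ _ * 'C(_, _)%:R)); lia.
- rewrite mul2_Omega_w [X in _ - X](mul2_same_side_r i c); try by_support.
  rewrite subr0; under eq_bigr => t _ do rewrite (mul2_Omega_w (gen_uw K (Pzw, l))).
  have [/andP[ck /eqP eM]|neM] := boolP ((c <= k) && (i + c == l + k))%N.
    have li : (l < i.+1)%N by lia.
    rewrite (bigD1 (Ordinal li)) //= big1 ?addr0 => [|t]; last first.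
      rewrite -val_eqE /= => /negbTE tl.
      by case: ifP => // ?; rewrite ?eqz_nat ?tl ?mulr0.
    rewrite ck !ifT ?eqxx ?mulr1 //=; [|lia..].
    by case: eqP => [_|]; rewrite ?mulr1 //; lia.
  rewrite big1 => [|t _].
    by case: ifP => // ck /=; rewrite ifF //; lia.
  have := ltn_ord t; rewrite ltnS => ti.
  case: ifP => tk; rewrite ?mulr0 //=.
  by case: (boolP (_ && _)) => /=; rewrite ?mulr0 //; move: neM; lia.
- rewrite (mul2_same_side i c) ?[X in 0 - X](mul2_same_side_r i c); try by_support.
  by rewrite subrr big1 // => t _; rewrite mul2_same_side ?mulr0 //; by_support.
Qed.

(** Substituting z = u + w in a series is adjoint to expanding (u + w)^s. *)
Lemma series_uw_adjoint f N (T : nat -> K) :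
  \sum_(i < N.+1) series_uw f i (N - i) * T i
    = \sum_(s < N.+1) f s (N - s)%N * \sum_(t < s.+1) 'C(s, t)%:R * T t.
Proof.
pose F s t := if (t <= s)%N then f s (N - s)%N * ('C(s, t)%:R * T t) else 0.
transitivity (\sum_(t < N.+1) \sum_(s < N.+1) F s t).
  apply: eq_bigr => t _; have tN : (t <= N)%N by rewrite -ltnS.
  rewrite -[RHS](big_mkord xpredT (F^~ t)).
  rewrite (big_cat_nat (n := t)) //=; last exact: ltnW.
  rewrite big_nat big1 ?add0r => [|s /andP[_ ts]]; last by rewrite /F leqNgt ts.
  rewrite -[X in index_iota X _]add0n big_addn subSn // big_mkord.
  rewrite /series_uw mulr_suml.
  apply: eq_bigr => k _; rewrite /F leq_addl addnC subnDA subnAC.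
  by rewrite -subnDA addnC subnDA; ring.
rewrite exchange_big; apply: eq_bigr => s _ /=.
rewrite mulr_sumr.
rewrite (big_ord_widen N.+1 (fun t => f s (N - s)%N * ('C(s, t)%:R * T t))) //.
rewrite [RHS]big_mkcond; apply: eq_bigr => t _; by rewrite /F ltnS.
Qed.

Definition gen_product (iota : gen -> dist2 K) (s : seq gen) : dist2 K :=
  foldr (fun g F => mul2 (iota g) F) (@one2 K) s.

Lemma gen_product1 iota g : gen_product iota [:: g] = iota g.
Proof. by apply/funext => m; apply/funext => n; apply: mul2_one2. Qed.

Lemma gen_product2 iota g g' : gen_product iota [:: g; g'] = mul2 (iota g) (iota g').
Proof.
rewrite /gen_product /= -[mul2 (iota g') _]/(gen_product iota [:: g']).
by rewrite gen_product1.
Qed.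

Lemma gen_product_degree iota s : (forall g, has_degree 1 (iota g)) ->
  has_degree (size s) (gen_product iota s).
Proof.
move=> iota1; elim: s => [|g s IHs] /=; first exact: one2_degree.
by rewrite -add1n; apply: mul2_degree.
Qed.

Lemma mul2_series_degree f F d m n : has_degree d F ->
  ((0 <= m)%R + (0 <= n)%R)%N != d -> mul2 (series2 f) F m n = 0.
Proof.
move=> dF; apply: contraNeq => /(mul2_degree (@series2_degree K f) dF) ->.
by rewrite add0n.
Qed.

(** The residue of f times a product of generators at z = infinity minus the one
    at z = 0 is the residue at z = w.  By degree, only products of one generator
    (if n = -1) or two generators (if n >= 0) contribute. *)
Lemma term_residue f s n : -1 <= n ->
  mul2 (series2 f) (gen_product (@gen_zw K) s) 0 n
  - mul2 (series2 f) (gen_product (@gen_wz K) s) 0 n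
  = mul2 (series2 (series_uw f)) (gen_product (@gen_uw K) s) 0 n.
Proof.
move=> n1.
have [sd|] := eqVneq ((0 <= 0 :> int)%R + (0 <= n)%R)%N (size s); last first.
  move=> sd; rewrite !(mul2_series_degree _ _ sd) ?subrr //;
    apply: gen_product_degree.
  - exact: gen_uw_degree.
  - exact: gen_wz_degree.
  exact: gen_zw_degree.
have [n0|n0] := boolP (0 <= n).
  move: s sd; rewrite n0 => -[|g [|g' []]] // _; rewrite !gen_product2.
  have w : g.2%:Z - 1 + (g'.2%:Z - 1) + 2 = (g.2 + g'.2)%:Z by lia.
  have wzw := mul2_weight (@gen_zw_weight g) (@gen_zw_weight g').
  have wwz := mul2_weight (@gen_wz_weight g) (@gen_wz_weight g').
  have wuw := mul2_weight (@gen_uw_weight g) (@gen_uw_weight g').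
  rewrite w in wzw wwz wuw; case: n n0 {n1} => // n _.
  have [nM|Mn] := leqP n (g.2 + g'.2); last first.
    have lt : (g.2 + g'.2)%:Z < 0 + n%:Z by lia.
    rewrite (mul2_series_lt _ wzw lt) (mul2_series_lt _ wwz lt).
    by rewrite (mul2_series_lt _ wuw lt) subrr.
  pose N := (g.2 + g'.2 - n)%N.
  have eN : (g.2 + g'.2)%:Z = 0 + n%:Z + N%:Z by rewrite /N; lia.
  rewrite (mul2_series _ wzw eN) (mul2_series _ wwz eN) (mul2_series _ wuw eN).
  rewrite -sumrB.
  pose T (t : nat) := mul2 (@gen_uw K g) (@gen_uw K g') t (n + (N - t))%N.
  transitivity (\sum_(i < N.+1) series_uw f i (N - i) * T i); last first.
    by apply: eq_bigr => i _; rewrite add0r.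
  rewrite series_uw_adjoint; apply: eq_bigr => i _.
  rewrite -mulrBr add0r -PoszD residue_identity_gens.
  congr (_ * _); apply: eq_bigr => t _; congr (_ * mul2 _ _ _ _).
  by have := ltn_ord t; have := ltn_ord i; lia.
have en : n = -1 by lia.
subst n => {n0 n1}.
case: s sd => [|g []] // _; rewrite !gen_product1.
have eN : g.2%:Z - 1 = 0 + -1 + g.2%:Z by lia.
rewrite (mul2_series _ (@gen_zw_weight g) eN).
rewrite (mul2_series _ (@gen_wz_weight g) eN).
rewrite (mul2_series _ (@gen_uw_weight g) eN).
(* The coefficient of w^0 only sees the terms of f without w. *)
have tr (i : 'I_g.2.+1) :
    truncated 0 i && truncated (-1) (g.2 - i) = (i == ord_max).
  by rewrite /truncated -val_eqE /=; have := ltn_ord i; lia.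
have sum1 (F : 'I_g.2.+1 -> K) :
    \sum_(i < g.2.+1)
      (if truncated 0 i && truncated (-1) (g.2 - i) then F i else 0) = F ord_max.
  by rewrite -big_mkcond (eq_bigl _ _ tr) big_pred1_eq.
rewrite !sum1 /= -mulrBr subnn !addr0 add0r /series_uw big_ord1 addn0 binn mul1r.
congr (_ * _); case: g {eN tr sum1} => -[] l /=;
  rewrite ?eqxx /= ?subrr //; rewrite ?ifT ?binn ?ifF ?subr0 //; lia.
Qed.

Lemma expand_residue e n : -1 <= n ->
  expand_zw e 0 n - expand_wz e 0 n = expand_uw e 0 n.
Proof.
move=> n1; rewrite /expand_zw /expand_wz /expand_uw /expand -sumrB.
by apply: eq_bigr => t _; rewrite -term_residue.
Qed.

Lemma term_regular f s (iota : gen -> dist2 K) :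
  (forall g, has_degree 1 (iota g)) ->
  mul2 (series2 f) (gen_product iota s) (-1) (-1) = if nilp s then f 0 0 else 0.
Proof.
move=> iota1; case: s => [|g s]; first by rewrite mul2_one2.
by rewrite (mul2_series_degree _ (gen_product_degree (s := g :: s) iota1)).
Qed.

Lemma expand_regular_wz e : expand_wz e (-1) (-1) = expand_zw e (-1) (-1).
Proof.
apply: eq_bigr => t _; rewrite !term_regular //.
- exact: gen_zw_degree.
exact: gen_wz_degree.
Qed.

Lemma expand_regular_uw e : expand_uw e (-1) (-1) = expand_zw e (-1) (-1).
Proof.
apply: eq_bigr => t _; rewrite !term_regular; last 2 first.
- exact: gen_zw_degree.
- exact: gen_uw_degree.
by rewrite /series_uw big_ord1 bin0 mul1r.
Qed.

(** Only f Omega^l_{z-w} contributes, and the identity says that setting z = 0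
    in f(z, w), that is u = -w in f(u + w, w), gives f(0, w).  The sum over k
    has to reach the order l of the pole, whence the bound N. *)
Lemma term_skew f s (N : nat) :
  all (fun g : gen => if g is (Pzw, l) then (l < N)%N else true) s ->
  mul2 (series2 f) (gen_product (@gen_wz K) s) (-1) 0
  - mul2 (series2 f) (gen_product (@gen_zw K) s) (-1) 0
  = \sum_(k < N) (-1) ^+ k
      * mul2 (series2 (series_uw f)) (gen_product (@gen_uw K) s) k%:Z (- k%:Z - 1).
Proof.
move=> sN; have [s1|s1] := eqVneq 1%N (size s); last first.
  rewrite big1 => [|k _].
    rewrite !(mul2_series_degree _ (gen_product_degree _)) ?subrr //.
    - exact: gen_zw_degree.
    exact: gen_wz_degree.
  rewrite (mul2_series_degree _ (gen_product_degree _)) ?mulr0 //.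
    exact: gen_uw_degree.
  by apply: contra s1; lia.
case: s s1 sN => [|g []] // _ sN; rewrite !gen_product1.
have eN : g.2%:Z - 1 = -1 + 0 + g.2%:Z by lia.
rewrite (mul2_series _ (@gen_zw_weight g) eN).
rewrite (mul2_series _ (@gen_wz_weight g) eN).
have tr (i : 'I_g.2.+1) :
    truncated (-1) i && truncated 0 (g.2 - i) = (i == ord0).
  by rewrite /truncated -val_eqE /=; have := ltn_ord i; lia.
have sum1 (F : 'I_g.2.+1 -> K) :
    \sum_(i < g.2.+1)
      (if truncated (-1) i && truncated 0 (g.2 - i) then F i else 0) = F ord0.
  by rewrite -big_mkcond (eq_bigl _ _ tr) big_pred1_eq.
rewrite !sum1 /= -mulrBr subn0 !addr0 add0r.
have eNk (k : nat) : g.2%:Z - 1 = k%:Z + (- k%:Z - 1) + g.2%:Z by lia.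
under [RHS]eq_bigr do rewrite (mul2_series _ (@gen_uw_weight g) (eNk _)).
case: g sN {eN eNk tr sum1} => -[] l sN /=.
- rewrite subrr mulr0 big1 // => k _; rewrite big1 ?mulr0 // => i _.
  by rewrite mulr0 if_same.
- rewrite subrr mulr0 big1 // => k _; rewrite big1 ?mulr0 // => i _.
  by rewrite mulr0 if_same.
have lN : (l < N)%N by move: sN => /=; rewrite andbT.
rewrite ifT; last by lia.
rewrite binn mulr1 subr0.
under [RHS]eq_bigr do rewrite mulr_sumr.
rewrite exchange_big /=.
(* Omega^l_u picks k = l - i. *)
transitivity (\sum_(i < l.+1) series_uw f i (l - i) * (-1) ^+ (l - i));
    last first.
  apply: eq_bigr => i _; have ltil := ltn_ord i; rewrite ltnS in ltil.
  have ltN : (l - i < N)%N by apply: leq_ltn_trans lN; apply: leq_subr.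
  rewrite (bigD1 (Ordinal ltN)) //= [X in _ = _ + X]big1 ?addr0 => [|k].
    rewrite ifT; last by rewrite /truncated; lia.
    by rewrite mulrC; congr (_ * _); rewrite (_ : _ && _ = true) ?mulr1 //; lia.
  rewrite -val_eqE /= => /eqP nek; rewrite (_ : _ && _ = false); last by lia.
  by rewrite mulr0 if_same mulr0.
rewrite (series_uw_adjoint f l (fun i => (-1) ^+ (l - i))).
rewrite big_ord_recl [X in _ = _ + X]big1 ?addr0 => [|s _].
  by rewrite /= big_ord1 bin0 mul1r !subn0.
rewrite (_ : \sum_(t < _) _ = 0) ?mulr0 //.
(* (1 - 1)^(s+1) = 0. *)
have := exprDn (1 : K) (-1) s.+1; rewrite subrr expr0n /=.
move=> /(congr1 (fun x => (-1) ^+ l * x)); rewrite mulr0 => e0.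
rewrite [RHS]e0 mulr_sumr; apply: eq_bigr => t _.
rewrite expr1n mul1r mulrnAr -[RHS]mulr_natl -exprD; congr (_ * _).
have -> : (l + t = l - t + t.*2)%N.
  by have := ltn_ord t; have := ltn_ord s; rewrite /bump /=; lia.
by rewrite exprD -mul2n exprM sqrrN !expr1n mulr1.
Qed.

Lemma expand_skew e (N : nat) : polar_below N e ->
  expand_wz e (-1) 0 - expand_zw e (-1) 0
  = \sum_(k < N) (-1) ^+ k * expand_uw e k%:Z (- k%:Z - 1).
Proof.
rewrite /expand_zw /expand_wz /expand_uw /expand -sumrB => eN.
under [RHS]eq_bigr do rewrite mulr_sumr.
rewrite exchange_big /=; elim: e eN => [|t e IHe] /=; first by rewrite !big_nil.
by case/andP=> tN eN; rewrite !big_cons IHe // (term_skew _ tN).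
Qed.

End Expansions.

(** * Linear functionals separate points *)

Section Functionals.
Variables (K : fieldType) (S : gcalg K) (V : lmodType S).

Lemma scale_algA k l (v : V) : k%:A *: (l%:A *: v) = (k * l)%:A *: v.
Proof. by rewrite scalerA mulr_algl scalerA. Qed.

Lemma scale_algD k l (v : V) : (k + l)%:A *: v = k%:A *: v + l%:A *: v.
Proof. by rewrite scalerDl scalerDl. Qed.

Lemma scale_algN k (v : V) : (- k)%:A *: v = - (k%:A *: v).
Proof. by rewrite scaleNr scaleNr. Qed.

Lemma scale_alg0 (v : V) : 0%:A *: v = 0.
Proof. by rewrite scale0r scale0r. Qed.

Lemma scale_alg1 (v : V) : 1%:A *: v = v.
Proof. by rewrite !scale1r. Qed.

(** A subspace that is maximal among those avoiding x is a complement of the line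
    of x, and the functional is the coordinate along x.  The subspaces of the
    proof may be empty, so that the union of the empty chain is one of them. *)
Lemma separating_functional (x : V) : x != 0 ->
  exists phi : V -> K, is_functional phi /\ phi x != 0.
Proof.
move=> x0.
pose avoiding (A : set V) :=
  (forall k u v, A u -> A v -> A (k%:A *: u + v)) /\ ~ A x.
have [|A [[Alin Ax] Amax]] := @Zorn_bigcup V avoiding.
  move=> F FP tot; split=> [k u v [B FB Bu] [C FC Cv]|[B FB]]; last first.
    by have [] := FP B FB.
  have [BC|CB] := tot B C FB FC.
    by exists C => //; have [lin _] := FP C FC; apply: lin => //; apply: BC.
  by exists B => //; have [lin _] := FP B FB; apply: lin => //; apply: CB.
have AZ k u : A 0 -> A u -> A (k%:A *: u).
  by move=> A0 Au; rewrite -[_ *: u]addr0; apply: Alin.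
have A0 : A 0.
  apply: contrapT => nA0.
  have nA u : ~ A u.
    by move=> Au; apply: nA0; have := Alin (-1) u u Au Au;
      rewrite scale_algN scale_alg1 addNr.
  apply: (Amax [set 0]%classic); first by split=> [u /nA //|/(_ 0 erefl)].
  split=> [k u v -> ->|/= /eqP]; first by rewrite scaler0 addr0.
  by rewrite (negbTE x0).
have coord v : exists k, A (v - k%:A *: x).
  have [Av|nAv] := pselect (A v); first by exists 0; rewrite scale_alg0 subr0.
  pose B := [set u | exists k, A (u - k%:A *: v)]%classic.
  have AB : (A `<` B)%classic.
    split=> [u Au|BA]; first by exists 0; rewrite scale_alg0 subr0.
    by apply/nAv/BA; exists 1; rewrite scale_alg1 subrr.
  have Blin k u w : B u -> B w -> B (k%:A *: u + w).
    move=> [i Ai] [j Aj]; exists (k * i + j).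
    have := Alin k _ _ Ai Aj; rewrite scalerBr scale_algA scale_algD.
    by rewrite opprD addrACA.
  have [k Ak] : B x by apply: contrapT => nBx; exact: (Amax B).
  have k0 : k != 0.
    by apply: contra_notN Ax => /eqP k0; move: Ak; rewrite k0 scale_alg0 subr0.
  exists k^-1; have := AZ (- k^-1) _ A0 Ak.
  by rewrite scale_algN scalerBr opprB scale_algA mulVf // scale_alg1.
pose phi v := projT1 (cid (coord v)).
have phiP v k : A (v - k%:A *: x) -> phi v = k.
  move=> Ak; rewrite /phi; case: cid => /= l Al; apply: contrapT => /eqP nlk.
  apply: Ax; have lk : k - l != 0 by rewrite subr_eq0 eq_sym.
  have := Alin (-1) _ _ Ak Al; rewrite scale_algN scale_alg1.
  rewrite opprB addrA subrK -scale_algN -scale_algD.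
  move=> /(AZ (k - l)^-1 _ A0).
  by rewrite scale_algA mulVf // scale_alg1.
exists phi; split; last first.
  by rewrite (phiP x 1) ?oner_neq0 // scale_alg1 subrr.
have phi_mem v : A (v - (phi v)%:A *: x) by rewrite /phi; case: cid.
split=> [u v|k v]; apply: phiP.
  have := Alin 1 _ _ (phi_mem u) (phi_mem v).
  by rewrite scale_alg1 scale_algD opprD addrACA.
have := AZ k _ A0 (phi_mem v).
by rewrite scalerBr scale_algA.
Qed.

(** This turns identities of matrix elements into identities of vectors. *)
Lemma functional_ext (u v : V) :
  (forall phi : V -> K, is_functional phi -> phi u = phi v) -> u = v.
Proof.
move=> uv; apply/eqP; rewrite -subr_eq0; apply: contrapT => /negP.
move=> /separating_functional[phi [[phiD phiZ]]].
have -> : u - v = u + (-1)%:A *: v by rewrite scale_algN scale_alg1.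
by rewrite phiD phiZ uv ?mulN1r ?subrr ?eqxx.
Qed.

End Functionals.

(** * Signs and spans *)

Lemma signT (S : pzRingType) (V : lmodType S) (v : V) : (-1) ^+ true *: v = - v.
Proof. by rewrite scaleN1r. Qed.

Lemma signF (S : pzRingType) (V : lmodType S) (v : V) : (-1) ^+ false *: v = v.
Proof. by rewrite scale1r. Qed.

Definition signE := (signT, signF).

Section Span.
Variables (V : zmodType) (P : V -> Prop).

Lemma span_mem v : P v -> span_of P v.
Proof. by exists [:: v]; rewrite big_seq1; split=> // u; rewrite inE => /eqP ->. Qed.

Lemma span0 : span_of P 0.
Proof. by exists [::]; rewrite big_nil. Qed.

Lemma spanD u v : span_of P u -> span_of P v -> span_of P (u + v).
Proof.
move=> [s [sP ->]] [t [tP ->]]; exists (s ++ t); rewrite big_cat; split=> // w.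
by rewrite mem_cat => /orP[/sP|/tP].
Qed.

Lemma span_ind (Q : V -> Prop) : Q 0 -> (forall u v, Q u -> Q v -> Q (u + v)) ->
  (forall v, P v -> Q v) -> forall v, span_of P v -> Q v.
Proof.
move=> Q0 QD PQ _ [s [sP ->]]; elim: s sP => [|u s IHs] sP; first by rewrite big_nil.
rewrite big_cons; apply: QD; first by apply/PQ/sP; rewrite mem_head.
by apply: IHs => w ws; apply: sP; rewrite inE ws orbT.
Qed.

Lemma spanN : (forall v, P v -> P (- v)) -> forall v, span_of P v -> span_of P (- v).
Proof.
move=> PN; apply: span_ind => [|u v|v /PN]; rewrite ?oppr0 ?opprD.
- exact: span0.
- exact: spanD.
exact: span_mem.
Qed.

End Span.

(** * Consequences of locality for the modes *)

Local Notation "a '_(' m ) v" := (rv_mode _ a m v)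
  (at level 30, m at level 99, v at level 30, format "a '_(' m )  v").

Section Modes.
Variables (K : fieldType) (S : gcalg K) (V : raviolo S).
Implicit Types (a b u v w : V) (m n : int).

Local Notation vac := (rv_vac V).
Local Notation der := (rv_der V).

Lemma modeDr a m u v : a _(m) (u + v) = a _(m) u + a _(m) v.
Proof. exact: rv_modeDr. Qed.

Lemma modeDl a b m v : (a + b) _(m) v = a _(m) v + b _(m) v.
Proof. exact: rv_modeDl. Qed.

Lemma mode0r a m : a _(m) 0 = 0.
Proof. by apply: (addIr (a _(m) 0)); rewrite -modeDr !add0r. Qed.

Lemma mode0l m v : 0 _(m) v = 0.
Proof. by apply: (addIr (0 _(m) v)); rewrite -modeDl !add0r. Qed.

Lemma modeNr a m v : a _(m) (- v) = - (a _(m) v).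
Proof. by apply/eqP; rewrite -addr_eq0 -modeDr addNr mode0r. Qed.

Lemma modeNl a m v : (- a) _(m) v = - (a _(m) v).
Proof. by apply/eqP; rewrite -addr_eq0 -modeDl addNr mode0l. Qed.

Lemma modeBl a b m v : (a - b) _(m) v = a _(m) v - b _(m) v.
Proof. by rewrite modeDl modeNl. Qed.

Lemma par_gr p r j v : rv_gr V p r j v -> rv_par V p v.
Proof. by move=> vV; apply: span_mem; exists r, j. Qed.

Lemma par0 p : rv_par V p 0. Proof. exact: span0. Qed.

Lemma parD p u v : rv_par V p u -> rv_par V p v -> rv_par V p (u + v).
Proof. exact: spanD. Qed.

Lemma grN p r j v : rv_gr V p r j v -> rv_gr V p r j (- v).
Proof.
have [gr0 grB _ _] := rv_dir V.
by move=> vV; have := grB (p, r, j) 0 v (gr0 (p, r, j)) vV; rewrite sub0r.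
Qed.

Lemma parN p v : rv_par V p v -> rv_par V p (- v).
Proof. by apply: spanN => u [r [j uV]]; exists r, j; apply: grN. Qed.

Lemma gr_alg k : gc_gr S false 0 k%:A.
Proof. by apply: gc_scale; apply: gc_one. Qed.

Lemma modeZr a m k v : a _(m) (k%:A *: v) = k%:A *: (a _(m) v).
Proof.
have [_ _ dec _] := rv_dir V; have [s [f [fV ->]]] := dec a.
have dist (w : V) :
    (\sum_(i <- s) f i) _(m) w = \sum_(i <- s) (f i) _(m) w.
  by apply: (big_morph (fun b => b _(m) w)) => [u u'|];
    [apply: modeDl|apply: mode0l].
rewrite !dist scaler_sumr; apply: eq_bigr => i _.
by rewrite (rv_modeZr _ _ (gr_alg k) (par_gr (fV i))) scale1r.
Qed.

Lemma modeZl a m k v : (k%:A *: a) _(m) v = k%:A *: (a _(m) v).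
Proof. by rewrite (rv_modeZl _ _ _ (gr_alg k)) scale1r. Qed.

Lemma par_mode p q a m b : rv_par V p a -> rv_par V q b ->
  rv_par V (p (+) q (+) (0 <= m)) (a _(m) b).
Proof.
move=> + bV; move: a; apply: span_ind => [|u v uV vV|a [r [j aV]]].
- by rewrite mode0l; apply: par0.
- by rewrite modeDl; apply: parD.
move: b bV; apply: span_ind => [|u v uV vV|b [t [i bV]]].
- by rewrite mode0r; apply: par0.
- by rewrite modeDr; apply: parD.
exact: par_gr (rv_mode_gr _ aV bV).
Qed.

Lemma par_decomp v : exists v0 v1,
  [/\ rv_par V false v0, rv_par V true v1 & v = v0 + v1].
Proof.
have [_ _ dec _] := rv_dir V; have [s [f [fV ->]]] := dec v.
elim: s => [|[[p r] j] s [v0 [v1 [v0V v1V e]]]].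
  by exists 0, 0; rewrite big_nil addr0; split=> //; apply: par0.
rewrite big_cons {}e; have := par_gr (fV (p, r, j)) => /=.
case: p => fpV.
  by exists v0, (f (true, r, j) + v1); rewrite addrCA; split=> //; apply: parD.
by exists (f (false, r, j) + v0), v1; rewrite addrA; split=> //; apply: parD.
Qed.

(** Locality is available for vectors of definite parity, and this extends its
    additive consequences to all vectors. *)
Lemma par_ind (P : V -> Prop) : (forall u v, P u -> P v -> P (u + v)) ->
  (forall p v, rv_par V p v -> P v) -> forall v, P v.
Proof.
move=> PD Ppar v; have [v0 [v1 [v0V v1V ->]]] := par_decomp v.
by apply: PD; [apply: (Ppar false)|apply: (Ppar true)].
Qed.

Lemma functional0 (phi : V -> K) : is_functional phi -> phi 0 = 0.
Proof. by move=> [phiD _]; apply: (addIr (phi 0)); rewrite -phiD !add0r. Qed.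

Lemma functionalN (phi : V -> K) v : is_functional phi -> phi (- v) = - phi v.
Proof.
move=> phiV; apply/eqP; rewrite -addr_eq0 -(proj1 phiV) addNr.
by rewrite functional0.
Qed.

Lemma functional_sign (phi : V -> K) (c : bool) v : is_functional phi ->
  phi ((-1) ^+ c *: v) = (-1) ^+ c * phi v.
Proof.
by move=> phiV; case: c; rewrite !signE ?mul1r // functionalN // mulN1r.
Qed.

Lemma functional_sum (phi : V -> K) (I : Type) (r : seq I) (F : I -> V) :
  is_functional phi -> phi (\sum_(i <- r) F i) = \sum_(i <- r) phi (F i).
Proof.
move=> phiV; apply: big_morph; last exact: functional0.
by case: phiV.
Qed.

(** In degree 0 the three expansions start with the same constant term f(0, 0),
    which explains this lemma and the next one. *)
Lemma regular_comm p q a b v : rv_par V p a -> rv_par V q b ->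
  a _(-1) (b _(-1) v) = (-1) ^+ (p && q) *: (b _(-1) (a _(-1) v)).
Proof.
move=> aV bV; have [L loc] := rv_local aV bV; apply: functional_ext => phi phiV.
have [e [_ zw wz _]] := loc v phi phiV.
have := expand_regular_wz e; rewrite zw wz /= !mul1r functional_sign // => ->.
Qed.

Lemma regular_assoc a b v : (a _(-1) b) _(-1) v = a _(-1) (b _(-1) v).
Proof.
move: a; apply: par_ind => [u u' e e'|p a aV].
  by rewrite !modeDl e e'.
move: b; apply: par_ind => [u u' e e'|q b bV].
  by rewrite modeDr !modeDl modeDr e e'.
have [L loc] := rv_local aV bV; apply: functional_ext => phi phiV.
have [e [_ zw _ uw]] := loc v phi phiV.
by have := expand_regular_uw e; rewrite zw uw /= mul1r.
Qed.

(** [expand_residue] says that a_(0), of parity p + 1, is a derivation of the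
    (-1)-product, and in the next lemma of the n-th product, whose own parity
    is odd. *)
Lemma residue_regular p q a b v : rv_par V p a -> rv_par V q b ->
  a _(0) (b _(-1) v)
    = (a _(0) b) _(-1) v + (-1) ^+ (~~ p && q) *: (b _(-1) (a _(0) v)).
Proof.
move=> aV bV; have [L loc] := rv_local aV bV; apply: functional_ext => phi phiV.
have [e [_ zw wz uw]] := loc v phi phiV.
have := expand_residue e (lexx (-1 : int)).
rewrite zw wz uw /= (proj1 phiV) functional_sign // mul1r => <-.
by case: p {aV loc zw wz uw}; case: q {bV} => /=; ring.
Qed.

Lemma residue_polar p q a b v (n : nat) : rv_par V p a -> rv_par V q b ->
  a _(0) (b _(n%:Z) v) = (-1) ^+ (~~ p) *: ((a _(0) b) _(n%:Z) v)
    + (-1) ^+ (~~ p && ~~ q) *: (b _(n%:Z) (a _(0) v)).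
Proof.
move=> aV bV; have [L loc] := rv_local aV bV; apply: functional_ext => phi phiV.
have [e [_ zw wz uw]] := loc v phi phiV.
have n1 : -1 <= n%:Z :> int by [].
have := expand_residue e n1.
rewrite zw wz uw /= (proj1 phiV) !functional_sign // => <-.
by case: p {aV loc zw wz uw}; case: q {bV} => /=; ring.
Qed.

(** On the vacuum a_(-1) b_(0) vanishes, so that [expand_skew] expresses
    b_(0) a_(-1) vac = b_(0) a. *)
Lemma skew_symmetry p q a b : rv_par V p a -> rv_par V q b ->
  exists L, forall N, (L <= N)%N -> b _(0) a = (-1) ^+ (p && q) *:
    \sum_(k < N) (-1) ^+ odd k *: ((a _(k%:Z) b) _(- k%:Z - 1) vac).
Proof.
move=> aV bV; have [L loc] := rv_local aV bV; exists L => N LN.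
apply: functional_ext => phi phiV.
have [e [polar zw wz uw]] := loc vac phi phiV.
have polarN : polar_below N e.
  apply: sub_all polar => t; apply: sub_all => -[[] l] // lL.
  exact: leq_trans LN.
have := expand_skew polarN.
rewrite zw wz /= rv_creation_reg mode0r functional0 // mulr0 subr0 mul1r.
rewrite rv_creation functional_sign // functional_sum //.
move=> skew; rewrite -[LHS](signrMK (p && q)) skew.
congr (_ * _); apply: eq_bigr => k _.
by rewrite uw functional_sign // signr_odd.
Qed.

End Modes.

(** * Direct sums and their components *)

Section Components.
Variables (V : zmodType) (I : choiceType) (W : I -> V -> Prop).

(** The sequence of indices is duplicate-free and may be larger than the support
    of f. *)
Definition decomposes (v : V) (f : I -> V) : Prop :=
  (forall i, W i (f i)) /\
  exists s : seq I, [/\ uniq s, forall i, i \notin s -> f i = 0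
                      & v = \sum_(i <- s) f i].

Hypothesis W0 : forall i, W i 0.
Hypothesis WB : forall i u v, W i u -> W i v -> W i (u - v).

Let WN i v : W i v -> W i (- v).
Proof. by move=> vW; rewrite -sub0r; apply: WB. Qed.

Let WD i u v : W i u -> W i v -> W i (u + v).
Proof. by move=> uW vW; rewrite -[v]opprK; apply/WB/WN. Qed.

Lemma support_widen (f : I -> V) (s t : seq I) : uniq s -> uniq t ->
  {subset s <= t} -> (forall i, i \notin s -> f i = 0) ->
  \sum_(i <- s) f i = \sum_(i <- t) f i.
Proof.
move=> us ut st f0; rewrite [RHS](bigID (mem s)) /=.
rewrite [X in _ + X]big1 ?addr0 => [|i /f0 //].
rewrite -[RHS]big_filter; apply: perm_big; apply: uniq_perm; rewrite ?filter_uniq //.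
by move=> i; rewrite mem_filter; case: (boolP (i \in s)) => // /st ->.
Qed.

Lemma decomposesD u v f g : decomposes u f -> decomposes v g ->
  decomposes (u + v) (fun i => f i + g i).
Proof.
move=> [fW [s [us s0 ->]]] [gW [t [ut t0 ->]]]; split=> [i|]; first exact: WD.
exists (undup (s ++ t)); rewrite undup_uniq; split=> // [i|].
  by rewrite mem_undup mem_cat negb_or => /andP[/s0 -> /t0 ->]; rewrite addr0.
rewrite big_split /=; congr (_ + _); apply: support_widen;
  rewrite ?undup_uniq // => i; by rewrite mem_undup mem_cat => ->; rewrite ?orbT.
Qed.

Lemma decomposesN v f : decomposes v f -> decomposes (- v) (fun i => - f i).
Proof.
move=> [fW [s [us s0 ->]]]; split=> [i|]; first exact: WN.
by exists s; rewrite sumrN; split=> // i /s0 ->; rewrite oppr0.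
Qed.

Lemma decomposes_homogeneous i v : W i v ->
  decomposes v (fun j => if j == i then v else 0).
Proof.
move=> vW; split=> [j|]; first by case: eqP => [->|].
exists [:: i]; rewrite big_seq1 eqxx; split=> // j.
by rewrite inE => /negbTE ->.
Qed.

Lemma span_decomposes v : span_of (fun u => exists i, W i u) v ->
  exists f, decomposes v f.
Proof.
move: v; apply: span_ind => [|u v [f uf] [g vg]|v [i vW]].
- by exists (fun=> 0); split=> //; exists [::]; rewrite big_nil.
- by exists (fun i => f i + g i); apply: decomposesD.
by exists (fun j => if j == i then v else 0); apply: decomposes_homogeneous.
Qed.

Lemma direct_sumP : (forall v, span_of (fun u => exists i, W i u) v) ->
  (forall (s : seq I) (f : I -> V), uniq s -> (forall i, W i (f i)) ->
     \sum_(i <- s) f i = 0 -> forall i, i \in s -> f i = 0) ->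
  direct_sum W.
Proof.
move=> gen indep; split=> // v.
by have [f [fW [s [_ _ ->]]]] := span_decomposes (gen v); exists s, f.
Qed.

End Components.

Section DirectSum.
Variables (V : zmodType) (I : choiceType) (W : I -> V -> Prop).
Hypothesis dirW : direct_sum W.

Let W0 : forall i, W i 0. Proof. by case: dirW. Qed.
Let WB : forall i u v, W i u -> W i v -> W i (u - v). Proof. by case: dirW. Qed.

Lemma direct_sum_span v : span_of (fun u => exists i, W i u) v.
Proof.
have [_ _ dec _] := dirW; have [s [f [fW ->]]] := dec v.
elim: s => [|i s IHs]; first by rewrite big_nil; apply: span0.
by rewrite big_cons; apply: spanD => //; apply: span_mem; exists i.
Qed.

Lemma decomposes_unique v f g : decomposes W v f -> decomposes W v g -> f =1 g.
Proof.
move=> vf /(decomposesN W0 WB)/(decomposesD W0 WB vf).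
rewrite subrr => -[fgW [s [us s0 e]]] i; apply/eqP; rewrite -subr_eq0; apply/eqP.
have [_ _ _ indep] := dirW.
have [/(indep _ _ us fgW (esym e))//|/s0 //] := boolP (i \in s).
Qed.

Definition component (v : V) : I -> V :=
  projT1 (cid (span_decomposes W0 WB (direct_sum_span v))).

Lemma componentP v : decomposes W v (component v).
Proof. by rewrite /component; case: cid. Qed.

Lemma component_mem i v : W i (component v i).
Proof. by have [fW _] := componentP v. Qed.

Lemma component_sum v : exists s, [/\ uniq s,
  forall i, i \notin s -> component v i = 0 & v = \sum_(i <- s) component v i].
Proof. by have [_] := componentP v. Qed.

Lemma componentD u v i : component (u + v) i = component u i + component v i.
Proof.
exact: (decomposes_unique (componentP _)
  (decomposesD W0 WB (componentP u) (componentP v))).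
Qed.

Lemma component_homogeneous i j v : W i v ->
  component v j = if j == i then v else 0.
Proof.
move=> vW; exact: (decomposes_unique (componentP _) (decomposes_homogeneous W0 vW)).
Qed.

Lemma component0 i : component 0 i = 0.
Proof. by rewrite (component_homogeneous i (W0 i)) eqxx. Qed.

Lemma component_big (J : Type) (r : seq J) (F : J -> V) i :
  component (\sum_(j <- r) F j) i = \sum_(j <- r) component (F j) i.
Proof.
by apply: (big_morph (component^~ i)) => [u v|];
  [apply: componentD|apply: component0].
Qed.

(** A map that sends distinct summands to distinct summands commutes with taking
    components.  The differential is an instance, with tau shifting the charge, and so are maps
    preserving each summand, with tau the identity. *)
Lemma component_shift (T : V -> V) (tau : I -> I) : {morph T : u v / u + v} ->
  injective tau -> (forall i v, W i v -> W (tau i) (T v)) ->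
  forall v i, component (T v) (tau i) = T (component v i).
Proof.
move=> TD tauI TW v i.
have T0 : T 0 = 0 by apply: (addIr (T 0)); rewrite -TD !add0r.
have [s [us s0 e]] := component_sum v.
rewrite {1}e (big_morph T TD T0) component_big.
have comp j : component (T (component v j)) (tau i) =
    if i == j then T (component v j) else 0.
  by rewrite (component_homogeneous _ (TW _ _ (component_mem j v))) inj_eq.
under eq_bigr do rewrite comp.
have [si|/s0 vi0] := boolP (i \in s).
  rewrite (bigD1_seq i) //= eqxx big1 ?addr0 // => j.
  by rewrite eq_sym => /negbTE ->.
by rewrite vi0 T0 big1 // => j _; case: eqP => // <-; rewrite vi0.
Qed.

(** Taking the i-th component of a vanishing sum isolates the i-th component of
    the summand with index c i, so that all components of each summand
    vanish. *)
Lemma direct_sum_coarsen (J : choiceType) (c : I -> J) :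
  direct_sum (fun j => span_of (fun v => exists2 i, c i = j & W i v)).
Proof.
have coarse i j v : span_of (fun v => exists2 i, c i = j & W i v) v ->
    c i != j -> component v i = 0.
  move=> + cij; move: v; apply: span_ind => [|u v u0 v0|v [k ck vW]].
  - exact: component0.
  - by rewrite componentD u0 v0 addr0.
  rewrite (component_homogeneous _ vW); case: eqP => // ik.
  by rewrite ik ck eqxx in cij.
apply: direct_sumP.
- by move=> j; apply: span0.
- move=> j u v uW vW; apply: spanD => //; apply: spanN vW => w [i ci wW].
  by exists i => //; rewrite -sub0r; apply: WB.
- move=> v; have := direct_sum_span v; move: v; apply: span_ind.
  + exact: span0.
  + exact: spanD.
  by move=> v [i vW]; apply: span_mem; exists (c i); apply: span_mem; exists i.
move=> t g ut gW g0 j jt.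
have [s [us _ ->]] := component_sum (g j); rewrite big1 // => i _.
have [cij|/coarse-> //] := eqVneq (c i) j.
have := component_big t g i; rewrite g0 component0 (bigD1_seq j) //= big1 ?addr0 //.
by move=> k; rewrite -cij eq_sym => /coarse; apply.
Qed.

End DirectSum.

(** Simultaneous decomposition: the components for W of an element of a summand
    of E stay in that summand, which therefore splits along W. *)
Lemma direct_sum_joint (V : zmodType) (I J : choiceType) (W : I -> V -> Prop)
    (E : J -> V -> Prop) : direct_sum W -> direct_sum E ->
  (forall i j v (dW : direct_sum W), E j v -> E j (component dW v i)) ->
  direct_sum (fun k : I * J => fun v => W k.1 v /\ E k.2 v).
Proof.
move=> dW dE WE; have [W0 WB _ _] := dW; have [E0 EB _ _] := dE.
apply: direct_sumP => [|k u v [uW uE] [vW vE]|v|s f us fP f0 k ks].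
- by [].
- by split; [apply: WB|apply: EB].
- have [s [_ _ ->]] := component_sum dE v.
  elim: s => [|j s IHs]; first by rewrite big_nil; apply: span0.
  rewrite big_cons; apply: spanD => // {IHs s}.
  have [s [_ _ ->]] := component_sum dW (component dE v j).
  elim: s => [|i s IHs]; first by rewrite big_nil; apply: span0.
  rewrite big_cons; apply: spanD => //; apply: span_mem; exists (i, j).
  by split=> /=; [exact: component_mem|apply: WE; exact: component_mem].
have := component_big dW s f k.1; rewrite f0 component0.
move=> /(congr1 (fun v => component dE v k.2)); rewrite component0 component_big.
have comp l : component dE (component dW (f l) k.1) k.2 =
    if k == l then f l else 0.
  have [fW fE] := fP l; rewrite (component_homogeneous dW _ fW).
  case: (eqVneq k l) => [->|].
    by rewrite eqxx (component_homogeneous dE _ fE) eqxx.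
  rewrite -pair_eqE /pair_eq negb_and; case: eqP => //= [_ /negbTE e|_ _].
    by rewrite (component_homogeneous dE _ fE) e.
  exact: component0.
under eq_bigr do rewrite comp.
rewrite (bigD1_seq k) //= eqxx big1 ?addr0 // => l.
by rewrite eq_sym => /negbTE ->.
Qed.

Lemma direct_sum_ext (V : zmodType) (I : choiceType) (W W' : I -> V -> Prop) :
  (forall i v, W i v <-> W' i v) -> direct_sum W -> direct_sum W'.
Proof.
move=> WW'; suff -> : W = W' by [].
by apply/funext => i; apply/funext => v; apply/propext.
Qed.

Lemma span_sub (V : zmodType) (P Q : V -> Prop) :
  (forall v, P v -> span_of Q v) -> forall v, span_of P v -> span_of Q v.
Proof. by move=> PQ; apply: span_ind => //; [apply: span0|apply: spanD]. Qed.

(** * The differential and the descent bracket on cochains *)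

Lemma par_direct (K : fieldType) (S : gcalg K) (V : raviolo S) :
  direct_sum (rv_par V).
Proof.
apply: direct_sum_ext (direct_sum_coarsen (rv_dir V) (fun i => i.1.1)) => p v.
split; apply: span_sub => u uV; apply: span_mem.
  by case: uV => -[[q r] j] /= <- uV; exists r, j.
by case: uV => r [j uV]; exists (p, r, j).
Qed.

Section Superconformal.
Variables (K : fieldType) (S : gcalg K) (V : raviolo S) (N : superconformal V).
Hypothesis K0 : [pchar K] =i pred0.
Implicit Types (a b u v w : V) (m : int).

Local Notation vac := (rv_vac V).
Local Notation der := (rv_der V).
Local Notation D := (DB_fun N).
Local Notation Q := (descendant N).

Lemma natK_neq0 n : n.+1%:R != 0 :> K.
Proof. by rewrite ((pcharf0P K).1 K0). Qed.

(** Positive integers act invertibly on V, which is where characteristic 0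
    enters. *)
Lemma mulrnK n v : (n.+1%:R^-1)%:A *: (v *+ n.+1) = v.
Proof.
have -> : v *+ n.+1 = (n.+1%:R)%:A *: v by rewrite !scaler_nat.
by rewrite scale_algA mulVf ?natK_neq0 // scale_alg1.
Qed.

Lemma DB_alg k v : D (k%:A *: v) = k%:A *: D v.
Proof. exact: modeZr. Qed.

(** The translation axiom only concerns the commutator with der.  Since der is
    Gamma_(0), the derivation property rewrites it as a statement on der b. *)
Lemma der_field b v (n : nat) :
  (der b) _(n%:Z) v = - (b _(n%:Z - 1) v) *+ n.
Proof.
move: b; apply: par_ind => [u u' e e'|q b bV].
  by rewrite raddfD !modeDl e e' opprD mulrnDl.
have := residue_polar v n (par_gr (sc_Gamma_gr N)) bV.
rewrite !sc_Gamma0 !signE => /eqP; rewrite -subr_eq rv_translation => /eqP <-.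
by rewrite mulNrn.
Qed.

(** Q^+ and Q^- are even, hence D and Q are odd derivations. *)
Lemma odd_regular q X b v : rv_par V false X -> rv_par V q b ->
  X _(0) (b _(-1) v) = (X _(0) b) _(-1) v + (-1) ^+ q *: (b _(-1) (X _(0) v)).
Proof. exact: residue_regular. Qed.

Lemma odd_polar q X b v (n : nat) : rv_par V false X -> rv_par V q b ->
  X _(0) (b _(n%:Z) v)
    = - ((X _(0) b) _(n%:Z) v) + (-1) ^+ (~~ q) *: (b _(n%:Z) (X _(0) v)).
Proof. by move=> XV bV; rewrite (residue_polar _ _ XV bV) signT. Qed.

Lemma Qp_par : rv_par V false (sc_Qp N). Proof. exact: par_gr (sc_Qp_gr N). Qed.
Lemma Qm_par : rv_par V false (sc_Qm N). Proof. exact: par_gr (sc_Qm_gr N). Qed.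

Lemma DB_par p v : rv_par V p v -> rv_par V (~~ p) (D v).
Proof. by move=> vV; have := par_mode 0 Qp_par vV; rewrite addbT. Qed.

Lemma descendant_par p v : rv_par V p v -> rv_par V (~~ p) (Q v).
Proof. by move=> vV; have := par_mode 0 Qm_par vV; rewrite addbT. Qed.

Lemma DB_der v : D (der v) = der (D v).
Proof.
by apply/eqP; rewrite eq_sym -subr_eq0 rv_translation mulr0z oppr0.
Qed.

(** The anticommutator is minus the zero mode of Q^+_(0) Q^-, that is of
    - Gamma - der sigma / 2, and the zero mode of der sigma vanishes. *)
Lemma homotopy v : D (Q v) + Q (D v) = der v.
Proof.
rewrite /DB_fun /descendant (odd_polar v 0 Qp_par Qm_par) signT subrK.
rewrite (sc_QpQm N 0) /= modeBl modeZl (der_field _ _ 0) mulr0n scaler0 subr0.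
by rewrite modeNl opprK sc_Gamma0.
Qed.

Lemma descendant_square v : Q (Q v) = 0.
Proof.
have : Q (Q v) *+ 2 = 0.
  rewrite mulr2n /descendant {1}(odd_polar v 0 Qm_par Qm_par) signT.
  by rewrite (sc_QmQm N 0) /= mode0l oppr0 add0r addNr.
by move=> /(congr1 (fun w => (2^-1)%:A *: w)); rewrite mulrnK scaler0.
Qed.

Lemma DB_descendant v : D v = 0 -> D (Q v) = der v.
Proof. by move=> dv; rewrite -homotopy dv /descendant mode0r addr0. Qed.

(** D reverses parity.  This reduces statements on cocycles to the homogeneous
    ones for which the derivation rules are available. *)
Lemma closed_components v0 v1 : rv_par V false v0 -> rv_par V true v1 ->
  D (v0 + v1) = 0 -> D v0 = 0 /\ D v1 = 0.
Proof.
move=> v0V v1V dv; pose comp := component (par_direct V).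
have comp_D p : D (comp (v0 + v1) p) = 0.
  rewrite /comp -(component_shift _ (DB_funD N) negb_inj) ?dv ?component0 //.
  exact: DB_par.
have := comp_D true; have := comp_D false; rewrite /comp !componentD.
rewrite !(component_homogeneous _ _ v0V, component_homogeneous _ _ v1V) /=.
by rewrite add0r addr0.
Qed.

(** Since D Q a = der a for a cocycle a, the modes a_(n-1) with n > 0 are
    homotopic to 0, and (Q a)_(0) commutes with D up to sign. *)
Lemma DB_descent_mode p a b (n : nat) : rv_par V p a -> D a = 0 ->
  D ((Q a) _(n%:Z) b) = a _(n%:Z - 1) b *+ n + (-1) ^+ p *: ((Q a) _(n%:Z) (D b)).
Proof.
move=> aV da; rewrite {1}/DB_fun (odd_polar b n Qp_par (descendant_par aV)).
rewrite -/(D (Q a)) DB_descendant // der_field negbK mulNrn opprK.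
by [].
Qed.

Lemma normal_closed u v : D u = 0 -> D v = 0 -> D (u _(-1) v) = 0.
Proof.
have [u0 [u1 [u0V u1V ->]]] := par_decomp u => du dv.
have [d0 d1] := closed_components u0V u1V du.
rewrite modeDl DB_funD /DB_fun (odd_regular _ Qp_par u0V) (odd_regular _ Qp_par u1V).
rewrite -!/(DB_fun N _) d0 d1 dv !mode0l !mode0r !scaler0; by rewrite !addr0.
Qed.

Definition is_exact v := exists w, v = D w.

Lemma exactD u v : is_exact u -> is_exact v -> is_exact (u + v).
Proof. by move=> [w ->] [w' ->]; exists (w + w'); rewrite DB_funD. Qed.

Lemma exactN u : is_exact u -> is_exact (- u).
Proof. by move=> [w ->]; exists (- w); rewrite /DB_fun modeNr. Qed.

Lemma exact_sign (c : bool) u : is_exact u -> is_exact ((-1) ^+ c *: u).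
Proof. by case: c; rewrite !signE //; apply: exactN. Qed.

Lemma exact_alg k u : is_exact u -> is_exact (k%:A *: u).
Proof. by move=> [w ->]; exists (k%:A *: w); rewrite DB_alg. Qed.

Lemma exact0 : is_exact 0.
Proof. by exists 0; rewrite DB_fun0. Qed.

Lemma normal_exactl w v : D v = 0 -> is_exact ((D w) _(-1) v).
Proof.
move=> dv; move: w; apply: par_ind => [u u' e e'|p w wV].
  by rewrite DB_funD modeDl; apply: exactD.
exists (w _(-1) v); rewrite {2}/DB_fun (odd_regular _ Qp_par wV).
by rewrite -!/(DB_fun N _) dv mode0r scaler0 addr0.
Qed.

Lemma normal_exactr u w : D u = 0 -> is_exact (u _(-1) (D w)).
Proof.
have [u0 [u1 [u0V u1V ->]]] := par_decomp u => du.
have [d0 d1] := closed_components u0V u1V du.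
rewrite modeDl; apply: exactD.
  exists (u0 _(-1) w); rewrite {2}/DB_fun (odd_regular _ Qp_par u0V).
  by rewrite -!/(DB_fun N _) d0 mode0l add0r signF.
exists (- (u1 _(-1) w)).
rewrite {2}/DB_fun modeNr (odd_regular _ Qp_par u1V).
by rewrite -!/(DB_fun N _) d1 mode0l add0r signT opprK.
Qed.

(** The bracket before antisymmetrisation, which changes nothing on
    cohomology. *)
Definition descent u v := (Q u) _(0) v.

Lemma descentDl u u' v : descent (u + u') v = descent u v + descent u' v.
Proof. by rewrite /descent /descendant modeDr modeDl. Qed.

Lemma DB_descent p a b : rv_par V p a -> D a = 0 ->
  D (descent a b) = (-1) ^+ p *: descent a (D b).
Proof. by move=> aV da; rewrite (DB_descent_mode b 0 aV da) mulr0n add0r. Qed.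

Lemma descent_closed u v : D u = 0 -> D v = 0 -> D (descent u v) = 0.
Proof.
have [u0 [u1 [u0V u1V ->]]] := par_decomp u => du dv.
have [d0 d1] := closed_components u0V u1V du.
rewrite descentDl DB_funD (DB_descent _ u0V) // (DB_descent _ u1V) //.
by rewrite dv /descent !mode0r !scaler0 addr0.
Qed.

Lemma descent_exactr u w : D u = 0 -> is_exact (descent u (D w)).
Proof.
have [u0 [u1 [u0V u1V ->]]] := par_decomp u => du.
have [d0 d1] := closed_components u0V u1V du.
rewrite descentDl; apply: exactD.
  by exists (descent u0 w); rewrite (DB_descent _ u0V) // signF.
exists (- descent u1 w).
by rewrite -sub0r DB_funB DB_fun0 sub0r (DB_descent _ u1V) // signT opprK.
Qed.

Lemma descent_exactl w v : D v = 0 -> is_exact (descent (D w) v).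
Proof.
move=> dv; move: w; apply: par_ind => [u u' e e'|p w wV].
  by rewrite DB_funD descentDl; apply: exactD.
have e : Q (D w) = der w - D (Q w) by rewrite -homotopy addrAC subrr add0r.
rewrite /descent e modeBl (der_field _ _ 0) mulr0n sub0r; apply: exactN.
exists (- ((Q w) _(0) v)).
rewrite {2}/DB_fun modeNr (odd_polar v 0 Qp_par (descendant_par wV)).
by rewrite -!/(DB_fun N _) dv mode0r scaler0 addr0 opprK.
Qed.

(** By the derivation property, the commutator of (Q a)_(0) and (Q b)_(0) is the
    zero mode of (Q a)_(0) Q b, and this is Q ((Q a)_(0) b) because Q Q = 0. *)
Lemma descent_jacobi p q a b c : rv_par V p a -> rv_par V q b ->
  descent a (descent b c)
    = descent (descent a b) c + (-1) ^+ (p && q) *: descent b (descent a c).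
Proof.
move=> aV bV; rewrite /descent.
rewrite (residue_polar c 0 (descendant_par aV) (descendant_par bV)) !negbK.
congr (_ + _).
rewrite {3}/descendant (odd_polar b 0 Qm_par (descendant_par aV)) negbK.
rewrite -!/(descendant N _) descendant_square mode0l oppr0 add0r.
by case: p {aV}; rewrite !signE // modeNl.
Qed.

Lemma descent_leibniz p q a b c : rv_par V p a -> rv_par V q b ->
  descent a (b _(-1) c)
    = (descent a b) _(-1) c + (-1) ^+ (p && q) *: (b _(-1) (descent a c)).
Proof.
move=> aV bV; rewrite /descent.
by rewrite (residue_regular c (descendant_par aV) bV) negbK.
Qed.

Lemma der_power_vacuum u (k : nat) :
  iter k der u = (u _(- k%:Z - 1) vac) *+ k`!.
Proof.
elim: k => [|k IHk] /=; first by rewrite rv_creation.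
rewrite IHk raddfMn /=.
have := rv_translation u (- k%:Z - 1) vac.
rewrite rv_der_vac mode0r subr0 => ->.
have -> : - k%:Z - 1 - 1 = - k.+1%:Z - 1 :> int by lia.
have -> : - k%:Z - 1 = - (k.+1%:Z) :> int by lia.
by rewrite mulrNz opprK -mulrnA factS.
Qed.

Lemma mulrnI n v w : v *+ n.+1 = w *+ n.+1 -> v = w.
Proof. by move=> /(congr1 (fun u => (n.+1%:R^-1)%:A *: u)); rewrite !mulrnK. Qed.

Lemma fact_mulrnI k v w : v *+ k`! = w *+ k`! -> v = w.
Proof. by rewrite -(prednK (fact_gt0 k)); apply: mulrnI. Qed.

(** This is der^k u / k!, without denominators. *)
Definition divided_der (k : nat) u := u _(- k%:Z - 1) vac.

Lemma divided_der0 u : divided_der 0 u = u.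
Proof. exact: rv_creation. Qed.

Lemma divided_derS k u : divided_der k (der u) = divided_der k.+1 u *+ k.+1.
Proof.
apply: (@fact_mulrnI k).
by rewrite -der_power_vacuum -mulrnA -factS -der_power_vacuum -iterSr.
Qed.

Lemma divided_der_exact k u : is_exact u -> is_exact (divided_der k u).
Proof.
move=> [w ->].
have iterD n : iter n der (D w) = D (iter n der w).
  by elim: n => //= n ->; rewrite DB_der.
have e : divided_der k (D w) *+ k`! = D (divided_der k w *+ k`!).
  by rewrite -!der_power_vacuum iterD.
exists (divided_der k w); apply: (@fact_mulrnI k); rewrite e.
elim: (k`!) => [|n IHn]; first by rewrite !mulr0n DB_fun0.
by rewrite !mulrS DB_funD IHn.
Qed.

(** Put x_k = (Q b)_(k) a and y_k = b_(k) (Q a).  Skew symmetry expresses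
    (Q a)_(0) b through the divided derivatives of the y_k.  As Q is a
    derivation, y_k is x_k + Q (b_(k) a) up to sign.  By [DB_descent_mode],
    b_(k) a = D x_(k+1) / (k + 1), and Q D = der - D Q.  Hence, modulo exact
    terms, y_k is x_k + der x_(k+1) / (k + 1), and the alternating sum of the
    divided derivatives telescopes to x_0 = (Q b)_(0) a. *)
Lemma descent_antisymmetric p q a b : rv_par V p a -> rv_par V q b ->
  D a = 0 -> D b = 0 ->
  is_exact (descent a b + (-1) ^+ (p && q) *: descent b a).
Proof.
move=> aV bV da db.
pose x (k : nat) := (Q b) _(k%:Z) a; pose y (k : nat) := b _(k%:Z) (Q a).
have xy k : is_exact ((-1) ^+ (~~ q) *: divided_der k (y k)
                   - (divided_der k (x k) + divided_der k.+1 (x k.+1))).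
  pose x' := (k.+1%:R^-1)%:A *: x k.+1.
  have ba : b _(k%:Z) a = D x'.
    rewrite DB_alg /x (DB_descent_mode _ _ bV db) da mode0r scaler0 addr0.
    have -> : k.+1%:Z - 1 = k%:Z by lia.
    by rewrite mulrnK.
  have -> : (-1) ^+ (~~ q) *: divided_der k (y k)
            = divided_der k ((-1) ^+ (~~ q) *: y k).
    by case: (~~ q); rewrite !signE // /divided_der modeNl.
  have -> : (-1) ^+ (~~ q) *: y k = x k + (der x' - D (Q x')).
    rewrite -homotopy addrAC subrr add0r -ba /descendant.
    by rewrite (odd_polar a k Qm_par bV) addNKr.
  rewrite /divided_der 2!modeDl modeNl -!/(divided_der _ _) divided_derS.
  have -> : divided_der k.+1 x' *+ k.+1 = divided_der k.+1 (x k.+1).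
    by rewrite /divided_der /x' modeZl scalerMnr mulrnK.
  rewrite opprD addrACA subrr add0r addrAC subrr add0r.
  by apply/exactN/divided_der_exact; exists (Q x').
have telescope M : is_exact ((-1) ^+ (~~ q) *:
      (\sum_(k < M) (-1) ^+ odd k *: divided_der k (y k))
    - (x 0%N - (-1) ^+ odd M *: divided_der M (x M))).
  elim: M => [|M IHM].
    by rewrite big_ord0 scaler0 divided_der0 signF subrr subr0; apply: exact0.
  rewrite big_ord_recr /= scalerDr.
  have := exactD IHM (exact_sign (odd M) (xy M)); congr is_exact.
  rewrite scalerBr scalerDr addrACA; congr (_ + _ + _).
    by case: (odd M); rewrite !signE ?scalerN.
  rewrite -opprD addrA subrK.
  by case: (odd M); rewrite !signE ?opprK.
have [L skew] := skew_symmetry bV (descendant_par aV).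
have [L' x0] := rv_field (Q b) a.
have := telescope (maxn L L'); rewrite [x (maxn L L')]x0 ?leq_maxr //.
rewrite /divided_der mode0l scaler0 subr0 => /(exact_sign (~~ (p && q))).
congr is_exact; rewrite [X in _ = X + _](skew (maxn L L')) ?leq_maxl //.
rewrite scalerBr; congr (_ + _).
  by case: p {aV skew}; case: q {bV xy telescope}; rewrite !signE ?opprK.
by case: (p && q); rewrite !signE ?opprK.
Qed.

End Superconformal.

(** * The grading by the twisted charge *)

Section BGrading.
Variables (K : fieldType) (S : gcalg K) (V : raviolo S) (N : superconformal V).
Implicit Types (a b u v w : V) (m : int).

Local Notation D := (DB_fun N).
Local Notation Q := (descendant N).
Local Notation sigma := (sc_sigma N).

Definition B_hom p (c : K) v := exists r j s,
  [/\ rv_gr V p r j v, sigma _(0) v = s%:A *: v & c = r + s].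

(** The part of given parity and twisted charge; all spins are allowed, since the
    cohomology is not graded by spin. *)
Definition B_charge p (c : K) : V -> Prop := span_of (B_hom p c).

Lemma B_chargeE p c v :
  span_of (fun u => exists j, B_gr N p c j u) v <-> B_charge p c v.
Proof.
split; apply: span_sub => u.
  move=> [j0]; move: u; apply: span_sub => u [r [j [s [uV su -> _]]]].
  by apply: span_mem; exists r, j, s.
move=> [r [j [s [uV su e]]]]; apply: span_mem; exists (j - s / 2); apply: span_mem.
by exists r, j, s.
Qed.

Lemma B_charge_par p c v : B_charge p c v -> rv_par V p v.
Proof.
by apply: span_sub => u [r [j [s [uV _ _]]]]; apply: par_gr uV.
Qed.

Lemma sigma_par : rv_par V true sigma.
Proof. exact: par_gr (sc_sigma_gr N). Qed.

(** sigma is odd, so that sigma_(0) is an even derivation, and S-charges add. *)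
Lemma sigma_mode_regular b v :
  sigma _(0) (b _(-1) v) = (sigma _(0) b) _(-1) v + b _(-1) (sigma _(0) v).
Proof.
move: b; apply: par_ind => [u u' e e'|q b bV].
  by rewrite modeDl !modeDr e e' !modeDl addrACA.
by rewrite (residue_regular v sigma_par bV) signF.
Qed.

Lemma sigma_mode_polar b v (n : nat) : sigma _(0) (b _(n%:Z) v)
  = (sigma _(0) b) _(n%:Z) v + b _(n%:Z) (sigma _(0) v).
Proof.
move: b; apply: par_ind => [u u' e e'|q b bV].
  by rewrite modeDl !modeDr e e' !modeDl addrACA.
by rewrite (residue_polar v n sigma_par bV) !signF.
Qed.

Lemma B_charge_bilinear (op : V -> V -> V) p c q d t e :
  (forall u u' v, op (u + u') v = op u v + op u' v) ->
  (forall u v v', op u (v + v') = op u v + op u v') ->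
  (forall u v, B_hom p c u -> B_hom q d v -> B_charge t e (op u v)) ->
  forall u v, B_charge p c u -> B_charge q d v -> B_charge t e (op u v).
Proof.
move=> opDl opDr op_hom u v + vV; move: u.
have op0l w : op 0 w = 0 by apply: (addIr (op 0 w)); rewrite -opDl !add0r.
have op0r w : op w 0 = 0 by apply: (addIr (op w 0)); rewrite -opDr !add0r.
apply: span_ind => [|u u' uB u'B|u uB].
- by rewrite op0l; apply: span0.
- by rewrite opDl; apply: spanD.
move: v vV; apply: span_ind => [|v v' vB v'B|v vB].
- by rewrite op0r; apply: span0.
- by rewrite opDr; apply: spanD.
exact: op_hom.
Qed.

Lemma B_charge_regular p c q d u v : B_charge p c u -> B_charge q d v ->
  B_charge (p (+) q) (c + d) (u _(-1) v).
Proof.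
apply: (B_charge_bilinear (op := fun u v => u _(-1) v)).
- by move=> *; apply: modeDl.
- by move=> *; apply: modeDr.
move=> {}u {}v [r [j [s [uV su ->]]]] [t [i [s' [vV sv ->]]]].
apply: span_mem; have := rv_mode_gr (-1) uV vV; rewrite /= addbF subr0 => uvV.
exists (r + t), (j + i - (-1)%:~R - 1), (s + s'); split; first exact: uvV;
  last by rewrite addrACA.
by rewrite sigma_mode_regular su sv modeZl modeZr -scale_algD.
Qed.

Lemma B_charge_residue p c q d u v : B_charge p c u -> B_charge q d v ->
  B_charge (~~ (p (+) q)) (c + d - 1) (u _(0) v).
Proof.
apply: (B_charge_bilinear (op := fun u v => u _(0) v)).
- by move=> *; apply: modeDl.
- by move=> *; apply: modeDr.
move=> {}u {}v [r [j [s [uV su ->]]]] [t [i [s' [vV sv ->]]]].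
apply: span_mem; have := rv_mode_gr 0 uV vV; rewrite /= addbT => uvV.
exists (r + t - 1), (j + i - 0%:~R - 1), (s + s'); split; first exact: uvV;
  last by rewrite [r + s + _]addrACA [LHS]addrAC.
by rewrite (sigma_mode_polar _ _ 0) su sv modeZl modeZr -scale_algD.
Qed.

Lemma Qp_charge : B_charge false 2 (sc_Qp N).
Proof.
apply: span_mem; exists 1, (3 / 2), 1; split=> //; first exact: sc_Qp_gr.
by rewrite (sc_sigmaQp N 0) scale_alg1.
Qed.

Lemma Qm_charge : B_charge false 0 (sc_Qm N).
Proof.
apply: span_mem; exists 1, (3 / 2), (-1); split=> //; first exact: sc_Qm_gr.
  by rewrite (sc_sigmaQm N 0) scale_algN scale_alg1.
by rewrite subrr.
Qed.

Lemma DB_charge p c v : B_charge p c v -> B_charge (~~ p) (c + 1) (D v).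
Proof.
move=> /(B_charge_residue Qp_charge); rewrite addFb; congr B_charge.
by rewrite addrAC addrC; congr (_ + _); rewrite addrK.
Qed.

(** Q^- has twisted charge 0 and Q^+ has twisted charge 2; a mode with
    nonnegative index lowers the charge by 1.  The bracket uses two such modes. *)
Lemma descent_charge p c q d u v : B_charge p c u -> B_charge q d v ->
  B_charge (p (+) q) (c + d - 2) (descent N u v).
Proof.
move=> /(B_charge_residue Qm_charge) + vV => /B_charge_residue/(_ vV).
rewrite addFb addNb negbK add0r; congr B_charge.
by rewrite -[2]/(1 + 1) opprD [c - 1 + d]addrAC addrA.
Qed.

Lemma vacuum_charge : B_charge false 0 (rv_vac V).
Proof.
apply: span_mem; exists 0, 0, 0; split; first exact: rv_vac_gr.
  by rewrite rv_creation_reg scale_alg0.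
by rewrite addr0.
Qed.

Lemma scale_charge p r s q t v : gc_gr S p r s -> B_charge q t v ->
  B_charge (p (+) q) (r + t) (s *: v).
Proof.
move=> sS; move: v; apply: span_ind => [|u v uB vB|v [r' [j [k [vV kv ->]]]]].
- by rewrite scaler0; apply: span0.
- by rewrite scalerDr; apply: spanD.
apply: span_mem; exists (r + r'), j, k; split; last by rewrite addrA.
  exact: rv_grZ.
rewrite (rv_modeZr _ _ sS sigma_par) andbF signF kv !scalerA.
by rewrite mulr_algl mulr_algr.
Qed.

(** sigma_(0) preserves parity, R-charge and spin, so that V has a
    simultaneous decomposition for all four gradings; the twisted charge
    coarsens it. *)
Lemma B_charge_direct : direct_sum (fun i : bool * K => B_charge i.1 i.2).
Proof.
apply: direct_sum_ext (direct_sum_coarsen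
  (direct_sum_joint (rv_dir V) (sc_Scharge N) _)
  (fun k => (k.1.1.1, k.1.1.2 + k.2))) => [[p c] v /=|[[p r] j] s v dV /= sv].
  split; apply: span_sub => u uV; apply: span_mem.
    by case: uV => -[[[q r] j] s] /= [<- <-] [uV su]; exists r, j, s.
  by case: uV => r [j [s [uV su ->]]]; exists (p, r, j, s).
have sD : {morph rv_mode V sigma 0 : u v / u + v} by move=> *; apply: modeDr.
rewrite -(component_shift dV sD (@inj_id _)); last first.
  move=> -[[q t] i] u /= /(rv_mode_gr 0 (sc_sigma_gr N)) /=.
  rewrite addbT negbK subr0 (addrC 1 t) (addrC 1 i) !addrK.
  exact.
rewrite sv.
have kD : {morph (fun v => s%:A *: v) : u v / u + v} by move=> *; apply: scalerDr.
rewrite (component_shift dV kD (@inj_id _)) //.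
move=> -[[q t] i] u /= /(rv_grZ (gr_alg S s)).
by rewrite addFb add0r.
Qed.

End BGrading.

(** * Representatives of cohomology classes *)

Section Representatives.
Variables (S : pzRingType) (V : lmodType S) (d : differential V).
Implicit Types (x y : cohomology d) (u v : V).

Lemma represents_closed x v : represents x v -> d v = 0.
Proof. by move=> [[u /= du] [<- _]]; apply/eqP. Qed.

Lemma closed_represents v : d v = 0 -> exists x : cohomology d, represents x v.
Proof.
move=> /eqP dv; exists (coh_class (Cocycle (d := d) dv)).
by exists (Cocycle (d := d) dv).
Qed.

Lemma represents_ex x : exists v, represents x v.
Proof. by have [z ->] := coh_classE x; exists (val z), z. Qed.

Lemma represents_eq x y u v : represents x u -> represents y v ->
  x = y <-> exists w, u - v = d w.
Proof. by move=> [z [<- ->]] [t [<- ->]]; apply: coh_classP. Qed.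

Lemma represents_inj x y v : represents x v -> represents y v -> x = y.
Proof.
move=> xv yv; apply/(represents_eq xv yv); exists 0.
by rewrite -[X in d X](subrr 0) difB !subrr.
Qed.

Lemma representsD x y u v : represents x u -> represents y v ->
  represents (x + y) (u + v).
Proof.
by move=> [z [<- ->]] [t [<- ->]]; exists (z + t); rewrite coh_classD raddfD.
Qed.

Lemma representsB x y u v : represents x u -> represents y v ->
  represents (x - y) (u - v).
Proof.
by move=> [z [<- ->]] [t [<- ->]]; exists (z - t); rewrite coh_classB raddfB.
Qed.

Lemma representsN x v : represents x v -> represents (- x) (- v).
Proof.
move=> xv; have := representsB (representsB xv xv) xv.
by rewrite !subrr !sub0r.
Qed.

Lemma represents0 : represents (0 : cohomology d) 0.
Proof.
have [v xv] := represents_ex (0 : cohomology d).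
by have := representsB xv xv; rewrite !subrr.
Qed.

Lemma representsZ s x v : represents x v -> represents (s *: x) (s *: v).
Proof.
move=> [z [<- ->]]; exists (cocycle_scale s z); split=> //.
by rewrite -coh_scale_class.
Qed.

Lemma represents_exact x u v : represents x u -> (exists w, v - u = d w) ->
  d v = 0 -> represents x v.
Proof.
move=> xu vu /closed_represents[y yv].
by have /(represents_eq yv xu) <- := vu.
Qed.

Definition representative x : V := projT1 (cid (represents_ex x)).

Lemma representativeP x : represents x (representative x).
Proof. by rewrite /representative; case: cid. Qed.

Definition class_of v : cohomology d := xget 0 [set x | represents x v]%classic.

Lemma class_ofP v : d v = 0 -> represents (class_of v) v.
Proof.
move=> /closed_represents[x xv].
exact: (xgetI (P := [set y : cohomology d | represents y v]%classic) _ xv).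
Qed.

(** A biadditive operation on V induces one on cohomology if it preserves
    cocycles and sends a cocycle and a coboundary to a coboundary.
    Stating this without gradings defines the operation on all classes at once,
    homogeneous or not. *)
Lemma induced_operation (op : V -> V -> V) :
  (forall u u' v, op (u + u') v = op u v + op u' v) ->
  (forall u v v', op u (v + v') = op u v + op u v') ->
  (forall u v, d u = 0 -> d v = 0 -> d (op u v) = 0) ->
  (forall w v, d v = 0 -> exists w', op (d w) v = d w') ->
  (forall u w, d u = 0 -> exists w', op u (d w) = d w') ->
  exists cop : cohomology d -> cohomology d -> cohomology d,
    forall x y u v, represents x u -> represents y v ->
      represents (cop x y) (op u v).
Proof.
move=> opDl opDr op_closed op_exactl op_exactr.
exists (fun x y => class_of (op (representative x) (representative y))).
move=> x y u v xu yv.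
have xu' := representativeP x; have yv' := representativeP y.
set u' := representative x in xu' *; set v' := representative y in yv' *.
have [du du'] := (represents_closed xu, represents_closed xu').
have [dv dv'] := (represents_closed yv, represents_closed yv').
apply: (@represents_exact _ (op u' v')).
- by apply: class_ofP; apply: op_closed.
- have [/(_ erefl)[w uw] _] := represents_eq xu xu'.
  have [/(_ erefl)[t vt] _] := represents_eq yv yv'.
  have -> : u = u' + d w by rewrite -uw addrC subrK.
  have -> : v = v' + d t by rewrite -vt addrC subrK.
  have dD a b : d (a + b) = d a + d b.
    have dN c : d (- c) = - d c.
      by rewrite -sub0r difB -[X in d X](subrr 0) difB subrr sub0r.
    by have := difB d a (- b); rewrite dN !opprK.
  rewrite opDl !opDr.
  have [w1 ->] := op_exactr u' t du'.
  have [w2 ->] := op_exactl w v' dv'.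
  have dt : d (d t) = 0 by rewrite -vt difB dv dv' subrr.
  have [w3 ->] := op_exactl w (d t) dt.
  exists (w1 + (w2 + w3)).
  by rewrite !dD -[op u' v' + _ + _]addrA addrAC subrr add0r.
exact: op_closed.
Qed.

End Representatives.

(** * The Poisson structure on cohomology *)

Section BCohomology.
Variables (K : fieldType) (S : gcalg K) (V : raviolo S) (N : superconformal V).
Hypothesis K0 : [pchar K] =i pred0.

Lemma homogeneous_ind (P : S -> Prop) :
  (forall s t, P s -> P t -> P (s + t)) -> P 0 ->
  (forall p r s, gc_gr S p r s -> P s) -> forall s, P s.
Proof.
move=> PD P0 Phom s; have [_ _ dec _] := gc_dir S; have [t [f [fS ->]]] := dec s.
elim: t => [|i t IHt]; first by rewrite big_nil.
by rewrite big_cons; apply: PD => //; apply: Phom.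
Qed.

Lemma normal_productZl s u v :
  normal_product (s *: u) v = s *: normal_product u v :> V.
Proof.
move: s; apply: homogeneous_ind => [s t e e'||p r s sS].
- by rewrite !scalerDl /normal_product modeDl -!/(normal_product _ _) e e'.
- by rewrite !scale0r /normal_product mode0l.
by rewrite /normal_product (rv_modeZl _ _ _ sS) andbF signF.
Qed.

(** The sign of moving s through the odd operator Q cancels the one of moving it
    out of a zero mode. *)
Lemma descentZl s u v : descent N (s *: u) v = s *: descent N u v.
Proof.
move: s; apply: homogeneous_ind => [s t e e'||p r s sS].
- by rewrite !scalerDl descentDl e e'.
- by rewrite !scale0r /descent /descendant mode0r mode0l.
rewrite /descent /descendant (rv_modeZr _ _ sS (Qm_par N)) /= andbT.
have -> : (-1) ^+ p *: (s *: rv_mode V (sc_Qm N) 0 u)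
        = s *: ((-1) ^+ p *: rv_mode V (sc_Qm N) 0 u).
  by case: p {sS}; rewrite !signE ?scalerN.
rewrite (rv_modeZl _ _ _ sS) andbT.
by case: p {sS}; rewrite !signE // modeNl scalerN opprK.
Qed.

Lemma descentZr p r s q u v : gc_gr S p r s -> rv_par V q u ->
  descent N u (s *: v) = (-1) ^+ (p && q) *: (s *: descent N u v).
Proof.
move=> sS uV; rewrite /descent (rv_modeZr _ _ sS (descendant_par N uV)).
by rewrite addbT negbK.
Qed.

(** The components of a cocycle are cocycles, and if a sum of cocycles of
    distinct degrees is D w, then each of them is D of a component of w. *)
Lemma cohomology_direct :
  direct_sum (fun i : bool * K => H_B_gr (N := N) i.1 i.2).
Proof.
have dU := B_charge_direct N.
have grP p c (x : H_B N) : H_B_gr p c x <->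
    exists v, represents x v /\ B_charge N p c v.
  by split=> -[v [xv vB]]; exists v; split=> //; apply/B_chargeE.
have tauI : injective (fun i : bool * K => (~~ i.1, i.2 + 1)).
  by move=> [p c] [q e] /= [/negb_inj -> /addIr ->].
have D_comp v i : DB_fun N (component dU v i)
    = component dU (DB_fun N v) (~~ i.1, i.2 + 1).
  rewrite -(component_shift dU (DB_funD N) tauI) //.
  by move=> [p c] u; apply: DB_charge.
have [U0 UB _ _] := dU.
apply: direct_sumP.
- move=> [p c] /=; apply/grP; exists 0; split; first exact: represents0.
  exact: (U0 (p, c)).
- move=> [p c] x y /= /grP[u [xu uB]] /grP[v [yv vB]]; apply/grP; exists (u - v).
  by split; [apply: representsB|apply: (UB (p, c))].
- move=> x; have [v xv] := represents_ex x.
  have dv : DB_fun N v = 0 := represents_closed xv.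
  have comp_closed i : DB_fun N (component dU v i) = 0.
    by rewrite D_comp dv component0.
  have [s [_ _ e]] := component_sum dU v.
  have sum_rep (t : seq (bool * K)) :
      represents (\sum_(i <- t) class_of (D_B N) (component dU v i))
        (\sum_(i <- t) component dU v i).
    elim: t => [|i t IHt]; first by rewrite !big_nil; apply: represents0.
    rewrite !big_cons; apply: representsD => //.
    by apply: class_ofP; apply: comp_closed.
  have -> : x = \sum_(i <- s) class_of (D_B N) (component dU v i).
    by apply: represents_inj xv _; rewrite {2}e.
  elim: s {e} => [|i s IHs]; first by rewrite big_nil; apply: span0.
  rewrite big_cons; apply: spanD => //; apply: span_mem; exists i; apply/grP.
  exists (component dU v i); split; first by apply: class_ofP; apply: comp_closed.
  exact: (component_mem dU i v).
move=> s f us fH f0 i is_.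
have gex j : exists v, represents (f j) v /\ B_charge N j.1 j.2 v by apply/grP.
pose g j := projT1 (cid (gex j)).
have gP j : represents (f j) (g j) /\ B_charge N j.1 j.2 (g j).
  by rewrite /g; case: cid.
have sum_rep (t : seq (bool * K)) :
    represents (\sum_(j <- t) f j) (\sum_(j <- t) g j).
  elim: t => [|j t IHt]; first by rewrite !big_nil; apply: represents0.
  by rewrite !big_cons; apply: representsD => //; case: (gP j).
have := sum_rep s; rewrite f0 => sum0.
have [/(_ erefl)[w gw] _] := represents_eq sum0 (represents0 _).
rewrite subr0 in gw.
have {}gw : _ = DB_fun N w := gw.
apply: (represents_inj (v := g i)); first by case: (gP i).
have gi : component dU (DB_fun N w) i = g i.
  rewrite -gw component_big (bigD1_seq i) //= big1 ?addr0 => [|j ji].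
    by rewrite (component_homogeneous dU _ (proj2 (gP i))) eqxx.
  rewrite (component_homogeneous dU _ (proj2 (gP j))).
  by rewrite eq_sym (negbTE ji).
apply: represents_exact (represents0 _) _ _.
  exists (component dU w (~~ i.1, i.2 - 1)).
  rewrite subr0 -gi -[LHS]/(component dU _ _) /= D_comp /= negbK subrK.
  by case: (i).
by case: (gP i) => /represents_closed.
Qed.

Lemma gr_represents p c (x : H_B N) : H_B_gr p c x ->
  exists v, represents x v /\ B_charge N p c v.
Proof. by move=> [v [xv vB]]; exists v; split=> //; apply/B_chargeE. Qed.

Lemma represents_gr p c (x : H_B N) v : represents x v -> B_charge N p c v ->
  H_B_gr p c x.
Proof. by move=> xv vB; exists v; split=> //; apply/B_chargeE. Qed.

Lemma represents_sign p (x : H_B N) v : represents x v ->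
  represents ((-1) ^+ p *: x) ((-1) ^+ p *: v).
Proof. exact: representsZ. Qed.

Lemma normal_product_descends : exists mul : H_B N -> H_B N -> H_B N,
  forall x y u v, represents x u -> represents y v ->
    represents (mul x y) (normal_product u v).
Proof.
apply: induced_operation => [u u' v|u v v'|u v|w v|u w].
- exact: modeDl.
- exact: modeDr.
- exact: normal_closed.
- exact: normal_exactl.
- exact: normal_exactr.
Qed.

Lemma descent_descends : exists br : H_B N -> H_B N -> H_B N,
  forall x y u v, represents x u -> represents y v ->
    represents (br x y) (descent N u v).
Proof.
apply: induced_operation => [u u' v|u v v'|u v|w v|u w].
- exact: descentDl.
- exact: modeDr.
- exact: descent_closed.
- exact: descent_exactl.
- exact: descent_exactr.
Qed.

Lemma vacuum_closed : DB_fun N (rv_vac V) = 0.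
Proof. exact: rv_creation_reg. Qed.

Theorem B_twist_poisson :
  exists (one : H_B N) (mul br : H_B N -> H_B N -> H_B N),
    [/\ represents one (rv_vac V),
        (forall x y u v, represents x u -> represents y v ->
           represents (mul x y) (normal_product u v)),
        (forall p q x y u v, rv_par V p u -> rv_par V q v ->
           represents x u -> represents y v ->
           represents (br x y) (descent_bracket N p q u v))
      & is_2shifted_poisson (@H_B_gr _ _ _ N) one mul br].
Proof.
have [mul mulP] := normal_product_descends.
have [br brP] := descent_descends.
have [one oneP] : exists one : H_B N, represents one (rv_vac V).
  exact: (closed_represents (d := D_B N) vacuum_closed).
exists one, mul, br; split=> //.
  move=> p q x y u v uV vV xu yv.
  have du : DB_fun N u = 0 := represents_closed xu.
  have dv : DB_fun N v = 0 := represents_closed yv.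
  have e : descent_bracket N p q u v - descent N u v
         = - ((2^-1)%:A *: (descent N u v + (-1) ^+ (p && q) *: descent N v u)).
    rewrite /descent_bracket -!/(descent N _ _).
    rewrite -[X in _ - X](mulrnK K0 1) -scalerBr -[RHS]scalerN; congr (_ *: _).
    by rewrite mulr2n opprD addrACA subrr add0r opprD addrC.
  have ex : is_exact N (descent_bracket N p q u v - descent N u v).
    by rewrite e; apply/exactN/exact_alg/(descent_antisymmetric K0).
  apply: (represents_exact (brP _ _ _ _ xu yv)) => //.
  have uv0 := descent_closed du dv; have vu0 := descent_closed dv du.
  rewrite -[dif _ _]/(DB_fun N _) /descent_bracket -!/(descent N _ _).
  rewrite DB_alg DB_funB uv0 sub0r.
  case: (p && q); rewrite !signE; last by rewrite vu0 oppr0 scaler0.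
  by rewrite -[X in DB_fun N X]sub0r DB_funB DB_fun0 vu0 subr0 oppr0 scaler0.
split.
- exact: cohomology_direct.
- move=> p r s q t x sS /gr_represents[v [xv vB]].
  exact: represents_gr (representsZ s xv) (scale_charge sS vB).
- move=> x y z; have [u xu] := represents_ex x.
  have [v yv] := represents_ex y; have [w zw] := represents_ex z.
  apply: represents_inj (mulP _ _ _ _ (representsD xu yv) zw) _.
  by rewrite /normal_product modeDl; apply: representsD; apply: mulP.
- move=> x y z; have [u xu] := represents_ex x.
  have [v yv] := represents_ex y; have [w zw] := represents_ex z.
  apply: represents_inj (mulP _ _ _ _ xu (representsD yv zw)) _.
  by rewrite /normal_product modeDr; apply: representsD; apply: mulP.
- move=> s x y; have [u xu] := represents_ex x; have [v yv] := represents_ex y.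
  apply: represents_inj (mulP _ _ _ _ (representsZ s xu) yv) _.
  by rewrite normal_productZl; apply: representsZ; apply: mulP.
- move=> p r s q t x y sS /gr_represents[u [xu /B_charge_par uV]].
  have [v yv] := represents_ex y.
  apply: represents_inj (mulP _ _ _ _ xu (representsZ s yv)) _.
  rewrite /normal_product (rv_modeZr _ _ sS uV) addbF.
  by apply: representsZ; apply: representsZ; apply: mulP.
- move=> p r x q t y /gr_represents[u [xu uB]] /gr_represents[v [yv vB]].
  exact: represents_gr (mulP _ _ _ _ xu yv) (B_charge_regular uB vB).
- exact: represents_gr oneP (vacuum_charge N).
- move=> x; have [u xu] := represents_ex x.
  apply: represents_inj (mulP _ _ _ _ oneP xu) _.
  by rewrite /normal_product rv_mode_vac.
- move=> x y z; have [u xu] := represents_ex x.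
  have [v yv] := represents_ex y; have [w zw] := represents_ex z.
  apply: represents_inj (mulP _ _ _ _ xu (mulP _ _ _ _ yv zw)) _.
  by rewrite /normal_product -regular_assoc; apply: (mulP) => //; apply: mulP.
- move=> p r x q t y /gr_represents[u [xu /B_charge_par uV]].
  move=> /gr_represents[v [yv /B_charge_par vV]].
  apply: represents_inj (mulP _ _ _ _ xu yv) _.
  have -> : normal_product u v = (-1) ^+ (p && q) *: normal_product v u.
    have := regular_comm (rv_vac V) uV vV; rewrite !rv_creation //.
  by apply: representsZ; apply: mulP.
- move=> x y z; have [u xu] := represents_ex x.
  have [v yv] := represents_ex y; have [w zw] := represents_ex z.
  apply: represents_inj (brP _ _ _ _ (representsD xu yv) zw) _.
  by rewrite descentDl; apply: representsD; apply: brP.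
- move=> x y z; have [u xu] := represents_ex x.
  have [v yv] := represents_ex y; have [w zw] := represents_ex z.
  apply: represents_inj (brP _ _ _ _ xu (representsD yv zw)) _.
  by rewrite /descent modeDr; apply: representsD; apply: brP.
- move=> s x y; have [u xu] := represents_ex x; have [v yv] := represents_ex y.
  apply: represents_inj (brP _ _ _ _ (representsZ s xu) yv) _.
  by rewrite descentZl; apply: representsZ; apply: brP.
- move=> p r s q t x y sS /gr_represents[u [xu /B_charge_par uV]].
  have [v yv] := represents_ex y.
  apply: represents_inj (brP _ _ _ _ xu (representsZ s yv)) _.
  rewrite (descentZr _ sS uV).
  by apply: representsZ; apply: representsZ; apply: brP.
- move=> p r x q t y /gr_represents[u [xu uB]] /gr_represents[v [yv vB]].
  exact: represents_gr (brP _ _ _ _ xu yv) (descent_charge uB vB).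
- move=> p r x q t y /gr_represents[u [xu /B_charge_par uV]].
  move=> /gr_represents[v [yv /B_charge_par vV]].
  have du : DB_fun N u = 0 := represents_closed xu.
  have dv : DB_fun N v = 0 := represents_closed yv.
  have yx := representsN (represents_sign (p && q) (brP _ _ _ _ yv xu)).
  apply/(represents_eq (brP _ _ _ _ xu yv) yx); rewrite opprK.
  exact: (descent_antisymmetric K0 uV vV du dv).
- move=> p r x q t y z /gr_represents[u [xu /B_charge_par uV]].
  move=> /gr_represents[v [yv /B_charge_par vV]].
  have [w zw] := represents_ex z.
  apply: represents_inj (brP _ _ _ _ xu (brP _ _ _ _ yv zw)) _.
  rewrite (descent_jacobi N K0 w uV vV).
  by apply: representsD; [|apply: represents_sign]; apply: (brP) => //; apply: brP.
- move=> p r x q t y z /gr_represents[u [xu /B_charge_par uV]].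
  move=> /gr_represents[v [yv /B_charge_par vV]].
  have [w zw] := represents_ex z.
  apply: represents_inj (brP _ _ _ _ xu (mulP _ _ _ _ yv zw)) _.
  rewrite (descent_leibniz N w uV vV).
  apply: representsD; first by apply: mulP => //; apply: brP.
  by apply: represents_sign; apply: mulP => //; apply: brP.
Qed.

End BCohomology.

Theorem theorem3p3p4 (R : realType) (S : gcalg R[i]) (V : raviolo S)
    (N : superconformal V) :
  exists (one : H_B N) (mul br : H_B N -> H_B N -> H_B N),
    [/\ represents one (rv_vac V),
        (forall x y u v, represents x u -> represents y v ->
           represents (mul x y) (normal_product u v)),
        (forall p q x y u v, rv_par V p u -> rv_par V q v ->
           represents x u -> represents y v ->
           represents (br x y) (descent_bracket N p q u v))
      & is_2shifted_poisson (@H_B_gr _ _ _ N) one mul br].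
Proof. exact: B_twist_poisson (pchar_num _). Qed.
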